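(* Let $(I_i,\sigma_i)$ and $(I_j,\sigma_j)$ be holomorphic Poisson structures on a smooth manifold $M$, with $\mathrm{Im}(\sigma_i)=\mathrm{Im}(\sigma_j)=Q$, and with associated generalized complex structures on $T\oplus T^*$ $$\mathcal{J}_k=\begin{pmatrix}I_k&Q\\0&-I_k^*\end{pmatrix},\qquad k=i,j.$$ Let $F_{ij}\in\Omega^2_{cl}(M,\mathbb{R})$ be a closed real 2-form satisfying $$I_j-I_i=QF_{ij},\qquad F_{ij}I_j+I_i^*F_{ij}=0.$$ Then the graph of $F_{ij}$ over the diagonal $\Delta\subset M\times M$, that is, $\Delta$ equipped with the Courant trivialization whose lift is $\tau_\Delta=\{(X+\xi,\;X+\xi-i_XF_{ij}) : X+\xi\in T\oplus T^*\}$, defines a generalized complex submanifold of $(M\times M,\overline{\mathcal{J}}_i\times\mathcal{J}_j)$, yielding an isomorphism of generalized complex manifolds $$(M,\mathcal{J}_i)\stackrel{\cong}{\longrightarrow}(M,\mathcal{J}_j).$$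
   Context: A holomorphic Poisson structure $(I,\sigma)$ is an integrable complex structure $I$ with a holomorphic section $\sigma=P+iQ$ of $\wedge^2T_{1,0}$ ($P=IQ$) with $[\sigma,\sigma]=0$. Bivectors are viewed as maps $T^*\to T$, 2-forms as maps $T\to T^*$, $X\mapsto i_XF$; $I^*$ is the transpose of $I$. The standard Courant algebroid $E=T\oplus T^*$ has pairing $\langle X+\xi,Y+\eta\rangle=\xi(Y)+\eta(X)$, anchor $\pi(X+\xi)=X$ and bracket $[X+\xi,Y+\eta]=[X,Y]+L_X\eta-i_Yd\xi$. $\overline E$ is $E$ with the opposite bilinear form (same bracket and anchor), and $\overline{\mathcal{J}}$ is the endomorphism $\mathcal{J}$ regarded on $\overline E$. A generalized complex structure is an orthogonal $\mathcal{J}$ with $\mathcal{J}^2=-1$ whose $+i$-eigenbundle is closed under the Courant bracket. For a submanifold $\iota:S\hookrightarrow N$ and a Courant algebroid $E$ over $N$ with anchor $\pi$, put $E_S=\pi^{-1}(TS)/\mathrm{Ann}(TS)$ with inherited bracket and pairing ($\mathrm{Ann}(TS)\subset T^*N$ embedded in $E$ by the dual of the anchor). A Courant trivialization along $S$ is an isotropic splitting $s:TS\to E_S$ with $s(TS)$ closed under the bracket; its lift is $\tau_S=\{e\in\iota^*E:\pi(e)\in TS,\ e+\mathrm{Ann}(TS)\in s(TS)\}$. It is a generalized complex submanifold of $(N,\mathcal{J})$ if $\mathcal{J}\tau_S=\tau_S$. An isomorphism of generalized complex manifolds $(M_0,\mathcal{J}_0)$, $(M_1,\mathcal{J}_1)$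 (with Courant algebroids $E_0,E_1$) is a Courant trivialization of $\overline{E}_0\times E_1$ along the graph in $M_0\times M_1$ of a diffeomorphism $M_0\to M_1$ which is a generalized complex submanifold of $(M_0\times M_1,\overline{\mathcal{J}}_0\times\mathcal{J}_1)$. *)

(* Defs.v *)
From HB Require Import structures.
From mathcomp Require Import all_boot all_order all_algebra complex.
From mathcomp Require Import boolp classical_sets functions cardinality reals.
From mathcomp Require Import interval_inference topology normedtype landau derive.

Set Implicit Arguments.
Unset Strict Implicit.
Unset Printing Implicit Defensive.

Import Order.TTheory GRing.Theory Num.Theory.
Import numFieldNormedType.Exports.

Local Open Scope classical_set_scope.
Local Open Scope ring_scope.

(** Smooth manifolds modelled on 'cV[R]_n, tensor fields on them, holomorphic
    Poisson structures, Courant algebroids and generalized complex structures.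
    The calculus is that of MathComp-Analysis, over R : realType. *)

(** ** Smooth maps and manifolds *)

Section Smooth.
Context {R : realType} {V W : normedModType R}.

Fixpoint Ck (k : nat) (U : set V) (f : V -> W) : Prop :=
  if k is l.+1 then
    (forall x, U x -> differentiable f x) /\ (forall v, Ck l U ('D_v f))
  else forall x, U x -> {for x, continuous f}.

(* f is C^infty on U; meaningful for U open *)
Definition smooth_on (U : set V) (f : V -> W) : Prop := forall k, Ck k U f.

End Smooth.

Section SmoothTheory.
Context {R : realType}.

Lemma differentiable_near0 (V W : normedModType R) (h : V -> W) (x : V) :
  (\forall y \near x, h y = 0) -> differentiable h x.
Proof.
move=> h0; have hx : h x = 0 by exact: nbhs_singleton h0.
have E : h \o shift x = cst (h x) + 'd (cst (0 : W)) x +o_ 0 id.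
  apply/eqaddoP => _ /posnumP[e]; near=> y.
  rewrite fctE /= !fctE /= diff_cst hx /= /cst.
  rewrite (_ : h (y + x) = 0) ?addr0 ?subr0 ?normr0 ?mulr_ge0//.
  near: y; have := h0; rewrite (near_shift 0) subr0 => {}h0.
  by apply: filterS h0 => y /=.
have c0 : continuous ('d (cst (0 : W)) x : V -> W).
  by apply: diff_continuous; exact: differentiable_cst.
by apply/diff_locallyP; rewrite (diff_unique c0 E); split.
Unshelve. all: by end_near. Qed.

Lemma near_eq_differentiable (V W : normedModType R) (f g : V -> W) (x : V) :
  (\forall y \near x, f y = g y) -> differentiable f x -> differentiable g x.
Proof.
move=> fg df; rewrite (_ : g = f + (g - f)); last by rewrite addrC subrK.
apply: differentiableD => //; apply: differentiable_near0.
by apply: filterS fg => y fgy; rewrite !fctE fgy subrr.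
Qed.

Lemma Ck_ext (V W : normedModType R) k (U : set V) (f g : V -> W) :
  open U -> (forall x, U x -> f x = g x) -> Ck k U f -> Ck k U g.
Proof.
move=> oU; elim: k f g => [|k IH] f g fg /=.
  move=> fc x Ux; have n : {near x, f =1 g}.
    by apply: filterS (open_nbhs_nbhs (conj oU Ux)) => y /fg.
  rewrite /prop_for /continuous_at -(fg x Ux).
  by apply: cvg_trans (fc x Ux); apply: near_eq_cvg.
move=> [df Df]; split; last first.
  move=> v; apply: IH (Df v) => x Ux; apply: near_eq_derive => //.
  by apply: filterS (open_nbhs_nbhs (conj oU Ux)) => y /fg.
move=> x Ux; apply: near_eq_differentiable (df x Ux).
by apply: filterS (open_nbhs_nbhs (conj oU Ux)) => y /fg.
Qed.

Lemma Ck_add (V W : normedModType R) k (U : set V) (f g : V -> W) :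
  open U -> Ck k U f -> Ck k U g -> Ck k U (f + g).
Proof.
move=> oU; elim: k f g => [|k IH] f g /= => [fc gc x Ux|[df Df] [dg Dg]].
  by apply: continuousD; [exact: fc|exact: gc].
split=> [x Ux|v]; first by apply: differentiableD; [exact: df|exact: dg].
apply: (@Ck_ext _ _ k U ('D_v f + 'D_v g)) => //; last exact: IH.
move=> x Ux; apply/esym/deriveD; apply: diff_derivable; [exact: df|exact: dg].
Qed.

Lemma derive_comp_linear (U V W : normedModType R) (f : V -> W)
    (L : {linear U -> V}) (x v : U) : 'D_v (f \o L) x = 'D_(L v) f (L x).
Proof.
rewrite /derive; set F := (X in X @ _); set G := (X in _ = lim (X @ _)).
by rewrite (_ : F = G)//; apply/funext => h; rewrite /F /G /= linearP.
Qed.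

Lemma Ck_comp_linear (U V W : normedModType R) k (A : set V) (f : V -> W)
    (L : {linear U -> V}) :
  continuous L -> Ck k A f -> Ck k (L @^-1` A) (f \o L).
Proof.
move=> Lc; elim: k f => [|k IH] f /= => [fc x Ax|[df Df]].
  by apply: continuous_comp; [exact: Lc|exact: fc].
split=> [x Ax|v].
  by apply: differentiable_comp; [exact: linear_differentiable|exact: df].
rewrite (_ : 'D_v (f \o L) = 'D_(L v) f \o L); first exact: IH.
by apply/funext => x; rewrite derive_comp_linear.
Qed.

Lemma derive_linear_comp (U V W : normedModType R) (f : U -> V)
    (L : {linear V -> W}) (x v : U) : continuous L -> differentiable f x ->
  'D_v (L \o f) x = L ('D_v f x).
Proof.
move=> Lc df; rewrite !deriveE//; last first.
  by apply: differentiable_comp => //; exact: linear_differentiable.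
rewrite diff_comp//; last exact: linear_differentiable.
by rewrite /= diff_lin.
Qed.

Lemma Ck_linear_comp (U V W : normedModType R) k (A : set U) (f : U -> V)
    (L : {linear V -> W}) :
  open A -> continuous L -> Ck k A f -> Ck k A (L \o f).
Proof.
move=> oA Lc; elim: k f => [|k IH] f /= => [fc x Ax|[df Df]].
  by apply: continuous_comp; [exact: fc|exact: Lc].
split=> [x Ax|v].
  by apply: differentiable_comp; [exact: df|exact: linear_differentiable].
apply: (@Ck_ext _ _ k A (L \o 'D_v f)) => //; last exact: IH.
by move=> x Ax; rewrite /= derive_linear_comp//; exact: df.
Qed.

Lemma Ck_subset (V W : normedModType R) k (A B : set V) (f : V -> W) :
  A `<=` B -> Ck k B f -> Ck k A f.
Proof.
move=> AB; elim: k f => [|k IH] f /= => [fc x /AB/fc//|[df Df]].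
by split=> [x /AB/df//|v]; exact: IH.
Qed.

Lemma continuous_mulmx m n p (A : 'M[R]_(m, n)) :
  continuous (mulmx A : 'M[R]_(n, p) -> 'M[R]_(m, p)).
Proof.
apply/(@linear_bounded_continuous R _ _ (mulmx A)).
apply/linear_boundedP.
near=> M => x; rewrite [leLHS]mx_normrE; apply/bigmax_leP; split => /=.
  by rewrite mulr_ge0//.
move=> [i j] _ /=; rewrite mxE (le_trans (ler_norm_sum _ _ _))//.
apply: (@le_trans _ _ (\sum_k (`|A i k| * `|x|))).
  apply: ler_sum => k _; rewrite normrM ler_wpM2l//.
  rewrite [leRHS]mx_normrE; apply: (le_bigmax _ (fun ij => `|x ij.1 ij.2|) (k, j)).
rewrite -mulr_suml ler_wpM2r//.
apply: (@le_trans _ _ (\sum_i \sum_k `|A i k|)).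
  by rewrite (bigD1 i)//= lerDl sumr_ge0// => ? _; rewrite sumr_ge0.
near: M; apply: nbhs_pinfty_ge; exact: num_real.
Unshelve. all: by end_near. Qed.

End SmoothTheory.

Section BlockSmooth.
Context {R : realType}.

Lemma usubmxE m n (x : 'cV[R]_(m + n)) : usubmx x = row_mx 1%:M 0 *m x.
Proof. by rewrite -{2}[x]vsubmxK mul_row_col mul1mx mul0mx addr0. Qed.

Lemma dsubmxE m n (x : 'cV[R]_(m + n)) : dsubmx x = row_mx 0 1%:M *m x.
Proof. by rewrite -{2}[x]vsubmxK mul_row_col mul1mx mul0mx add0r. Qed.

Lemma col_mxE m n (x : 'cV[R]_m) (y : 'cV[R]_n) :
  col_mx x y = col_mx 1%:M 0 *m x + col_mx 0 1%:M *m y.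
Proof. by rewrite !mul_col_mx !mul1mx !mul0mx add_col_mx addr0 add0r. Qed.

Lemma continuous_usubmx m n : continuous (@usubmx R m n 1).
Proof.
by rewrite (_ : usubmx = mulmx (row_mx 1%:M 0));
  [exact: continuous_mulmx|apply/funext => x; rewrite usubmxE].
Qed.

Lemma continuous_dsubmx m n : continuous (@dsubmx R m n 1).
Proof.
by rewrite (_ : dsubmx = mulmx (row_mx 0 1%:M));
  [exact: continuous_mulmx|apply/funext => x; rewrite dsubmxE].
Qed.

Lemma open_preimage (T U : topologicalType) (f : T -> U) (D : set U) :
  continuous f -> open D -> open (f @^-1` D).
Proof. by move=> cf; apply: open_comp => x _; exact: cf. Qed.

Lemma smooth_on_col_mx m0 m1 n0 n1 (U0 : set 'cV[R]_m0) (U1 : set 'cV[R]_m1)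
    (f0 : 'cV[R]_m0 -> 'cV[R]_n0) (f1 : 'cV[R]_m1 -> 'cV[R]_n1) :
  open U0 -> open U1 -> smooth_on U0 f0 -> smooth_on U1 f1 ->
  smooth_on [set x | U0 (usubmx x) /\ U1 (dsubmx x)]
    (fun x => col_mx (f0 (usubmx x)) (f1 (dsubmx x))).
Proof.
move=> oU0 oU1 s0 s1 k; set U := [set x | _].
have oU : open U.
  apply: (@openI _ (usubmx @^-1` U0) (dsubmx @^-1` U1)).
    by apply: open_preimage oU0; exact: continuous_usubmx.
  by apply: open_preimage oU1; exact: continuous_dsubmx.
rewrite (_ : (fun x => _) =
  (mulmx (col_mx 1%:M 0) \o (f0 \o mulmx (row_mx 1%:M 0))) +
  (mulmx (col_mx 0 1%:M) \o (f1 \o mulmx (row_mx 0 1%:M)))); last first.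
  by apply/funext => x; rewrite col_mxE usubmxE dsubmxE.
apply: Ck_add => //; apply: Ck_linear_comp => //; try exact: continuous_mulmx.
- apply: (@Ck_subset _ _ _ _ _ (mulmx (row_mx 1%:M 0) @^-1` U0)).
    by move=> x [+ _]; rewrite /= usubmxE.
  by apply: Ck_comp_linear => //; exact: continuous_mulmx.
- apply: (@Ck_subset _ _ _ _ _ (mulmx (row_mx 0 1%:M) @^-1` U1)).
    by move=> x [_ +]; rewrite /= dsubmxE.
  by apply: Ck_comp_linear => //; exact: continuous_mulmx.
Qed.

End BlockSmooth.

Section Chart.
Context {R : realType}.

(* [chart_inv] is only meaningful on the image of [chart_dom] *)
Record chart (n : nat) (M : topologicalType) := Chart {
  chart_dom : set M;
  chart_fun : M -> 'cV[R]_n;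
  chart_inv : 'cV[R]_n -> M;
  open_chart_dom : open chart_dom;
  open_chart_codom : open (chart_fun @` chart_dom);
  chart_funK : {in chart_dom, cancel chart_fun chart_inv};
  chart_fun_continuous : forall p, chart_dom p -> {for p, continuous chart_fun};
  chart_inv_continuous :
    forall x, (chart_fun @` chart_dom) x -> {for x, continuous chart_inv}
}.

Arguments open_chart_dom {n M} c.
Arguments open_chart_codom {n M} c.

Lemma open_setX (M N : topologicalType) (A : set M) (B : set N) :
  open A -> open B -> open (A `*` B).
Proof.
move=> oA oB; rewrite openE => -[p q] [/= Ap Bq]; exists (A, B) => //=.
by split; exact: open_nbhs_nbhs.
Qed.

Section ProdChart.
Variables (m n : nat) (M N : topologicalType) (c : chart m M) (d : chart n N).

Let pdom : set (M * N) := chart_dom c `*` chart_dom d.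
Let pcoord (pq : M * N) := col_mx (chart_fun c pq.1) (chart_fun d pq.2).
Let pparam (x : 'cV[R]_(m + n)) : M * N :=
  (chart_inv c (usubmx x), chart_inv d (dsubmx x)).

Lemma prod_codom : pcoord @` pdom =
  [set x | (chart_fun c @` chart_dom c) (usubmx x) /\ (chart_fun d @` chart_dom d) (dsubmx x)].
Proof.
apply/seteqP; split => [_ [[p q] [/= cp dq] <-]|x [[p cp xp] [q dq xq]]] /=.
  by rewrite /pcoord col_mxKu col_mxKd; split; [exists p|exists q].
by exists (p, q) => //; rewrite /pcoord /= xp xq vsubmxK.
Qed.

Let open_pdom : open pdom.
Proof. by apply: open_setX; exact: open_chart_dom. Qed.

Let open_pcodom : open (pcoord @` pdom).
Proof.
rewrite prod_codom; apply: (@openI _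
    (usubmx @^-1` (chart_fun c @` chart_dom c)) (dsubmx @^-1` (chart_fun d @` chart_dom d))).
  by apply: open_preimage (open_chart_codom c); exact: continuous_usubmx.
by apply: open_preimage (open_chart_codom d); exact: continuous_dsubmx.
Qed.

Let pcoordK : {in pdom, cancel pcoord pparam}.
Proof.
move=> [p q]; rewrite inE => -[/= cp dq].
by rewrite /pparam /pcoord col_mxKu col_mxKd !chart_funK ?inE.
Qed.

Let pcoord_continuous pq : pdom pq -> {for pq, continuous pcoord}.
Proof.
case: pq => p q [/= cp dq].
rewrite (_ : pcoord = fun pq => col_mx 1%:M 0 *m chart_fun c pq.1 +
                                col_mx 0 1%:M *m chart_fun d pq.2); last first.
  by apply/funext => -[p' q']; rewrite /pcoord col_mxE.
apply: continuousD; (apply: continuous_comp; last exact: continuous_mulmx).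
  by apply: continuous_comp; [exact: cvg_fst|exact: chart_fun_continuous].
by apply: continuous_comp; [exact: cvg_snd|exact: chart_fun_continuous].
Qed.

Let pparam_continuous x : (pcoord @` pdom) x -> {for x, continuous pparam}.
Proof.
rewrite prod_codom => -[cx dx].
have pc : {for x, continuous (chart_inv c \o usubmx)}.
  apply: continuous_comp; first exact: continuous_usubmx.
  exact: chart_inv_continuous.
have pd : {for x, continuous (chart_inv d \o dsubmx)}.
  apply: continuous_comp; first exact: continuous_dsubmx.
  exact: chart_inv_continuous.
exact: cvg_pair pc pd.
Qed.

Definition prod_chart : chart (m + n) (M * N)%type :=
  Chart open_pdom open_pcodom pcoordK pcoord_continuous pparam_continuous.

End ProdChart.

Lemma hausdorff_prod (M N : topologicalType) :
  hausdorff_space M -> hausdorff_space N -> hausdorff_space (M * N)%type.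
Proof.
move=> hM hN [p q] [p' q'] clpq; congr pair.
  apply: hM => A B nA nB.
  have [] := clpq [set z | A z.1] [set z | B z.1].
  - exact: cvg_fst.
  - exact: cvg_fst.
  by move=> [a b] [/= Aa Ba]; exists a.
apply: hN => A B nA nB.
have [] := clpq [set z | A z.2] [set z | B z.2].
- exact: cvg_snd.
- exact: cvg_snd.
by move=> [a b] [/= Aa Ba]; exists b.
Qed.

Lemma second_countable_prod (M N : topologicalType) :
  @second_countable M -> @second_countable N ->
  @second_countable (M * N)%type.
Proof.
move=> [A cA [oA bA]] [B cB [oB bB]].
exists [set C.1 `*` C.2 | C in A `*` B].
  apply: (card_le_trans (card_image_le _ _)); exact: countableX.
split => [_ [[C D] [/= AC BD] <-]|[p q] U [[V W] /= [nV nW] VWU]].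
  by apply: open_setX; [exact: oA|exact: oB].
have [C [AC Cp] CV] := bA p V nV; have [D [BD Dq] DW] := bB q W nW.
exists (C `*` D); first by split; [exists (C, D)|].
by move=> [a b] [/= Ca Db]; apply: VWU; split => /=; [exact: CV|exact: DW].
Qed.

(* The atlas is the family of the charts [chart_at p]; [chart_at p] is also the
   chart in which the tensors at p are written. *)
Record manifold (n : nat) := Manifold {
  pt :> topologicalType;
  chart_at : pt -> chart n pt;
  dom_chart_at : forall p, chart_dom (chart_at p) p;
  chart_compat : forall p q,
    smooth_on (chart_fun (chart_at p) @` (chart_dom (chart_at p) `&` chart_dom (chart_at q)))
              (chart_fun (chart_at q) \o chart_inv (chart_at p));
  manifold_hausdorff : hausdorff_space pt;
  manifold_second_countable : @second_countable pt
}.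

Section ProdManifold.
Variables (m n : nat) (M : manifold m) (N : manifold n).

Let pchart (pq : M * N) := prod_chart (chart_at pq.1) (chart_at pq.2).

Let dom_pchart pq : chart_dom (pchart pq) pq.
Proof. by split; exact: dom_chart_at. Qed.

Lemma open_overlap k (T : topologicalType) (c d : chart k T) :
  open (chart_fun c @` (chart_dom c `&` chart_dom d)).
Proof.
rewrite (_ : _ @` _ = (chart_fun c @` chart_dom c) `&` (chart_inv c @^-1` chart_dom d)).
  rewrite openE => x [cx dx].
  apply: filterI; first by apply: open_nbhs_nbhs; split => //; exact: open_chart_codom.
  apply: (chart_inv_continuous cx); apply: open_nbhs_nbhs.
  by split => //; exact: open_chart_dom.
apply/seteqP; split => [_ [p [cp dp] <-]|_ [[p cp <-]]] /=.
  by split; [exists p|rewrite chart_funK ?inE].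
by rewrite chart_funK ?inE// => dp; exists p.
Qed.

Let pchart_compat p q :
  smooth_on (chart_fun (pchart p) @` (chart_dom (pchart p) `&` chart_dom (pchart q)))
            (chart_fun (pchart q) \o chart_inv (pchart p)).
Proof.
have H := smooth_on_col_mx
  (@open_overlap _ _ (chart_at p.1) (chart_at q.1))
  (@open_overlap _ _ (chart_at p.2) (chart_at q.2))
  (@chart_compat _ M p.1 q.1) (@chart_compat _ N p.2 q.2).
move=> k; apply: Ck_subset (H k) => _ [[a b] [[/= pa pb] [/= qa qb]] <-] /=.
by rewrite col_mxKu col_mxKd; split; [exists a|exists b].
Qed.

Definition prod_manifold : manifold (m + n) :=
  Manifold dom_pchart pchart_compat
    (hausdorff_prod (@manifold_hausdorff _ M) (@manifold_hausdorff _ N))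
    (second_countable_prod (@manifold_second_countable _ M)
                           (@manifold_second_countable _ N)).

End ProdManifold.
End Chart.

Arguments chart R n M : clear implicits.
Arguments manifold R n : clear implicits.

(** ** Tensor fields

    For M : manifold n, the fibers T_pM and T*_pM are both 'cV_n, through the
    coordinates of the chart [chart_at p].  A tensor field is a function
    assigning to p its matrix in these coordinates; [transition p q] changes
    coordinates at q from [chart_at q] to [chart_at p], and [act] (one of the
    representations of GL_n below) tells how the tensors of the given type
    transform.  Endomorphisms, bivectors (as maps T* -> T) and 2-forms (as maps
    T -> T* ) are matrices acting on columns, so that composition is [*m] and
    transposition of maps is [^T]. *)

Section Fields.
Context {R : realType}.

Definition jac k n (f : 'cV[R]_n -> 'cV[R]_k) (x : 'cV[R]_n) : 'M[R]_(k, n) :=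
  \matrix_(i, j) ('D_(delta_mx j 0) f x) i 0.

Definition vec_act n (A : 'M[R]_n) (X : 'cV[R]_n) := A *m X.
Definition end_act n (A I : 'M[R]_n) := A *m I *m invmx A.
Definition biv_act n (A P : 'M[R]_n) := A *m P *m A^T.
Definition form_act n (A F : 'M[R]_n) := (invmx A)^T *m F *m invmx A.

(* E = T (+) T*, with X + xi written [col_mx X xi] *)
Definition cou_mx n (A : 'M[R]_n) : 'M[R]_(n + n) :=
  block_mx A 0 0 (invmx A)^T.
Definition cou_act n (A : 'M[R]_n) (e : 'cV[R]_(n + n)) := cou_mx A *m e.
Definition cou_end_act n (A : 'M[R]_n) (J : 'M[R]_(n + n)) :=
  cou_mx A *m J *m invmx (cou_mx A).

Section OneManifold.
Variables (n : nat) (M : manifold R n).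

Definition transition (p q : M) : 'M[R]_n :=
  jac (chart_fun (chart_at p) \o chart_inv (chart_at q)) (chart_fun (chart_at q) q).

Section Act.
Variables (k l : nat) (act : 'M[R]_n -> 'M[R]_(k, l) -> 'M[R]_(k, l)).

Definition local_rep (T : M -> 'M[R]_(k, l)) (p : M) (x : 'cV[R]_n) :=
  let q := chart_inv (chart_at p) x in act (transition p q) (T q).

Definition smooth_field (W : set M) (T : M -> 'M[R]_(k, l)) :=
  forall p, smooth_on (chart_fun (chart_at p) @` (W `&` chart_dom (chart_at p)))
                      (local_rep T p).

(* partial derivatives at p of the components of T in the chart [chart_at p] *)
Definition partial (T : M -> 'M[R]_(k, l)) (p : M) (j : 'I_n) :
    'M[R]_(k, l) :=
  'D_(delta_mx j 0) (local_rep T p) (chart_fun (chart_at p) p).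

(* sections of the complexified bundles *)
Definition toC k' l' (A : 'M[R]_(k', l')) : 'M[R[i]]_(k', l') :=
  map_mx (real_complex R) A.
Definition ReM k' l' (A : 'M[R[i]]_(k', l')) : 'M[R]_(k', l') :=
  map_mx (@complex.Re R) A.
Definition ImM k' l' (A : 'M[R[i]]_(k', l')) : 'M[R]_(k', l') :=
  map_mx (@complex.Im R) A.

Definition smooth_fieldC (W : set M) (T : M -> 'M[R[i]]_(k, l)) :=
  smooth_field W (fun p => ReM (T p)) /\ smooth_field W (fun p => ImM (T p)).

Definition partialC (T : M -> 'M[R[i]]_(k, l)) (p : M) (j : 'I_n) :
    'M[R[i]]_(k, l) :=
  toC (partial (fun p => ReM (T p)) p j) +
  'i%C *: toC (partial (fun p => ImM (T p)) p j).

End Act.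
End OneManifold.

Definition along (K : comPzRingType) n k l (d : 'I_n -> 'M[K]_(k, l))
    (v : 'cV[K]_n) : 'M[K]_(k, l) := \sum_j v j 0 *: d j.

Definition jac_mx (K : comPzRingType) n k (d : 'I_n -> 'cV[K]_k) :
    'M[K]_(k, n) := \matrix_(i, j) d j i 0.

End Fields.

(** ** Holomorphic Poisson structures and closed 2-forms *)

Section HolomorphicPoisson.
Context {R : realType} {n : nat} {M : manifold R n}.

Definition lie_bracket (X Y : M -> 'cV[R]_n) (p : M) : 'cV[R]_n :=
  jac_mx (partial (@vec_act R n) Y p) *m X p
  - jac_mx (partial (@vec_act R n) X p) *m Y p.

Definition nijenhuis (I : M -> 'M[R]_n) (X Y : M -> 'cV[R]_n) (p : M) :
    'cV[R]_n :=
  let IX q := I q *m X q in let IY q := I q *m Y q in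
  lie_bracket IX IY p - I p *m lie_bracket IX Y p - I p *m lie_bracket X IY p
  - lie_bracket X Y p.

Record integrable_complex (I : M -> 'M[R]_n) : Prop := {
  ic_smooth : smooth_field (@end_act R n) setT I;
  ic_sqr : forall p, I p *m I p = - 1%:M;
  ic_integrable : forall (W : set M) (X Y : M -> 'cV[R]_n), open W ->
    smooth_field (@vec_act R n) W X -> smooth_field (@vec_act R n) W Y ->
    forall p, W p -> nijenhuis I X Y p = 0
}.

Definition lie_bivector (Z : M -> 'cV[R[i]]_n) (sigma : M -> 'M[R[i]]_n)
    (p : M) : 'M[R[i]]_n :=
  let DZ := jac_mx (partialC (@vec_act R n) Z p) in
  along (partialC (@biv_act R n) sigma p) (Z p)
  - DZ *m sigma p - sigma p *m DZ^T.

Definition proj10 (I : 'M[R]_n) : 'M[R[i]]_n :=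
  2^-1 *: (1%:M - 'i%C *: toC I).

(* dbar sigma = 0, where dbar_Z sigma = (L_Z sigma)^(2,0) for Z in T_(0,1) *)
Definition dbar_closed (I : M -> 'M[R]_n) (sigma : M -> 'M[R[i]]_n) :=
  forall (W : set M) (Z : M -> 'cV[R[i]]_n), open W ->
    smooth_fieldC (@vec_act R n) W Z ->
    (forall p, W p -> toC (I p) *m Z p = - 'i%C *: Z p) ->
    forall p, W p ->
      proj10 (I p) *m lie_bivector Z sigma p *m (proj10 (I p))^T = 0.

(* components of [sigma,sigma], up to a constant factor *)
Definition schouten (sigma : M -> 'M[R[i]]_n) (p : M) (a b c : 'I_n) : R[i] :=
  let d := partialC (@biv_act R n) sigma p in
  \sum_l (sigma p l a * d l b c + sigma p l b * d l c a
          + sigma p l c * d l a b).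

Record holomorphic_poisson (I : M -> 'M[R]_n) (sigma : M -> 'M[R[i]]_n) :
    Prop := {
  hp_complex : integrable_complex I;
  hp_smooth : smooth_fieldC (@biv_act R n) setT sigma;
  hp_skew : forall p, (sigma p)^T = - sigma p;
  (* sigma takes its values in T_(1,0); with sigma = P + iQ this is P = IQ *)
  hp_type : forall p, toC (I p) *m sigma p = 'i%C *: sigma p;
  hp_holomorphic : dbar_closed I sigma;
  hp_poisson : forall p a b c, schouten sigma p a b c = 0
}.

Record closed_2form (F : M -> 'M[R]_n) : Prop := {
  cf_smooth : smooth_field (@form_act R n) setT F;
  cf_skew : forall p, (F p)^T = - F p;
  cf_closed : forall p a b c,
    let d := partial (@form_act R n) F p in
    d a b c + d b c a + d c a b = 0
}.

End HolomorphicPoisson.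

(** ** Courant algebroids and generalized complex structures *)

Section Courant.
Context {R : realType}.

Definition std_pairing n (e e' : 'cV[R]_(n + n)) : R :=
  ((dsubmx e)^T *m usubmx e' + (dsubmx e')^T *m usubmx e) 0 0.

(* [X,Y] + L_X eta - i_Y d xi in coordinates, as a function of the values and
   the Jacobian matrices of X + xi and Y + eta at a point *)
Definition bracket_formula (K : comPzRingType) n (e e' : 'cV[K]_(n + n))
    (De De' : 'M[K]_(n + n, n)) : 'cV[K]_(n + n) :=
  let X := usubmx e in let DX := usubmx De in let Dxi := dsubmx De in
  let Y := usubmx e' in let DY := usubmx De' in
  let eta := dsubmx e' in let Deta := dsubmx De' in
  col_mx (DY *m X - DX *m Y)
         ((Deta *m X + DX^T *m eta) - (Dxi *m Y - Dxi^T *m Y)).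

Definition std_bracket n (M : manifold R n) (e e' : M -> 'cV[R]_(n + n))
    (p : M) : 'cV[R]_(n + n) :=
  bracket_formula (e p) (e' p) (jac_mx (partial (@cou_act R n) e p))
                               (jac_mx (partial (@cou_act R n) e' p)).

Definition std_bracketC n (M : manifold R n) (e e' : M -> 'cV[R[i]]_(n + n))
    (p : M) : 'cV[R[i]]_(n + n) :=
  bracket_formula (e p) (e' p) (jac_mx (partialC (@cou_act R n) e p))
                               (jac_mx (partialC (@cou_act R n) e' p)).

Record generalized_complex n (M : manifold R n) (J : M -> 'M[R]_(n + n)) :
    Prop := {
  gc_smooth : smooth_field (@cou_end_act R n) setT J;
  gc_sqr : forall p, J p *m J p = - 1%:M;
  gc_orthogonal : forall p e e',
    std_pairing (J p *m e) (J p *m e') = std_pairing e e';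
  gc_integrable : forall (W : set M) (e e' : M -> 'cV[R[i]]_(n + n)), open W ->
    smooth_fieldC (@cou_act R n) W e -> smooth_fieldC (@cou_act R n) W e' ->
    (forall p, W p -> toC (J p) *m e p = 'i%C *: e p) ->
    (forall p, W p -> toC (J p) *m e' p = 'i%C *: e' p) ->
    forall p, W p ->
      toC (J p) *m std_bracketC e e' p = 'i%C *: std_bracketC e e' p
}.

(* structure maps of a Courant algebroid whose underlying vector bundle is
   T (+) T*; the axioms are not part of the record *)
Record courant n (M : manifold R n) := MkCourant {
  anchor : M -> 'cV[R]_(n + n) -> 'cV[R]_n;
  pairing : M -> 'cV[R]_(n + n) -> 'cV[R]_(n + n) -> R;
  bracket : (M -> 'cV[R]_(n + n)) -> (M -> 'cV[R]_(n + n)) ->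
            M -> 'cV[R]_(n + n)
}.

(** *** The product of (T (+) T* of M, with opposite pairing) and
        (T (+) T* of N)

    As a vector bundle over M x N, p_M^*(T (+) T* ) (+) p_N^*(T (+) T* ) is
    T (+) T* of M x N; [fst_part], [snd_part] and [pair_part] are this
    identification. *)

Definition fst_part m n (e : 'cV[R]_((m + n) + (m + n))) : 'cV[R]_(m + m) :=
  col_mx (usubmx (usubmx e)) (usubmx (dsubmx e)).
Definition snd_part m n (e : 'cV[R]_((m + n) + (m + n))) : 'cV[R]_(n + n) :=
  col_mx (dsubmx (usubmx e)) (dsubmx (dsubmx e)).
Definition pair_part m n (e0 : 'cV[R]_(m + m)) (e1 : 'cV[R]_(n + n)) :
    'cV[R]_((m + n) + (m + n)) :=
  col_mx (col_mx (usubmx e0) (usubmx e1)) (col_mx (dsubmx e0) (dsubmx e1)).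

(* (X0 + xi0, X1 + xi1) |-> (X0, X1) + (- xi0, xi1) *)
Definition flip m n (e : 'cV[R]_((m + n) + (m + n))) :
    'cV[R]_((m + n) + (m + n)) :=
  col_mx (usubmx e) (col_mx (- usubmx (dsubmx e)) (dsubmx (dsubmx e))).

(* X + xi |-> X - xi identifies T (+) T* carrying the opposite pairing with
   T (+) T*, compatibly with anchors and brackets.  Hence [flip] identifies the
   product Courant algebroid with T (+) T* of M x N, from which its bracket is
   transported: it is componentwise on sections pulled back from the factors,
   which determines it by the Leibniz rules. *)
Definition opp_prod_courant m n (M : manifold R m) (N : manifold R n) :
    courant (prod_manifold M N) :=
  @MkCourant (m + n) (prod_manifold M N)
    (fun _ e => usubmx e)
    (fun _ e e' => - std_pairing (fst_part e) (fst_part e')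
                   + std_pairing (snd_part e) (snd_part e'))
    (fun e e' pq => flip (std_bracket (M := prod_manifold M N)
                            (fun z => flip (e z)) (fun z => flip (e' z)) pq)).

Definition opp_prod_end m n (M : manifold R m) (N : manifold R n)
    (J0 : M -> 'M[R]_(m + m)) (J1 : N -> 'M[R]_(n + n))
    (pq : prod_manifold M N) (e : 'cV[R]_((m + n) + (m + n))) :=
  pair_part (J0 pq.1 *m fst_part e) (J1 pq.2 *m snd_part e).

End Courant.

(** ** Courant trivializations and generalized complex submanifolds *)

Section Submanifold.
Context {R : realType} {k n : nat} {S : manifold R k} {N : manifold R n}.

Definition smooth_map (f : S -> N) :=
  continuous f /\
  forall p, smooth_on
    (chart_fun (chart_at p) @`
       (chart_dom (chart_at p) `&` f @^-1` chart_dom (chart_at (f p))))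
    (chart_fun (chart_at (f p)) \o f \o chart_inv (chart_at p)).

Definition tangent_map (f : S -> N) (p : S) : 'M[R]_(n, k) :=
  jac (chart_fun (chart_at (f p)) \o f \o chart_inv (chart_at p))
      (chart_fun (chart_at p) p).

Record embedding (f : S -> N) : Prop := {
  emb_smooth : smooth_map f;
  emb_inj : injective f;
  emb_homeo : forall U : set S, open U -> exists2 V, open V & U = f @^-1` V;
  emb_immersion : forall p, \rank (tangent_map f p) = k
}.

(* smooth sections of f^*(T (+) T* ) over W *)
Definition smooth_along (f : S -> N) (W : set S) (e : S -> 'cV[R]_(n + n)) :=
  forall p, smooth_on
    (chart_fun (chart_at p) @`
       (W `&` chart_dom (chart_at p) `&` f @^-1` chart_dom (chart_at (f p))))
    (fun x => let q := chart_inv (chart_at p) x in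
              cou_act (transition (f p) (f q)) (e q)).

Variables (C : courant N) (f : S -> N).

(* the image of Ann(TS) in E under the dual of the anchor *)
Definition ann (p : S) : set 'cV[R]_(n + n) :=
  [set a | exists2 zeta : 'cV[R]_n,
     forall v : 'cV[R]_k, zeta^T *m (tangent_map f p *m v) = 0 &
     forall e, pairing C (f p) a e = (zeta^T *m anchor C (f p) e) 0 0].

(* elements of E_S = pi^-1(TS) / Ann(TS) are represented by cosets in E *)
Definition ann_coset (p : S) (e : 'cV[R]_(n + n)) : set 'cV[R]_(n + n) :=
  [set e + a | a in ann p].

Definition ct_lift (s : S -> 'cV[R]_k -> set 'cV[R]_(n + n)) (p : S) :
    set 'cV[R]_(n + n) :=
  [set e | (exists v, anchor C (f p) e = tangent_map f p *m v) /\
           (exists v, ann_coset p e = s p v)].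

Record courant_trivialization (s : S -> 'cV[R]_k -> set 'cV[R]_(n + n)) :
    Prop := {
  ct_splitting : forall p v,
    exists2 e, anchor C (f p) e = tangent_map f p *m v & s p v = ann_coset p e;
  ct_linear : forall p a v w e e', s p v e -> s p w e' ->
    s p (a *: v + w) (a *: e + e');
  ct_smooth : forall (W : set S) (X : S -> 'cV[R]_k), open W ->
    smooth_field (@vec_act R k) W X ->
    exists2 e, smooth_along f W e & forall p, W p -> s p (X p) (e p);
  ct_isotropic : forall p v w e e', s p v e -> s p w e' ->
    pairing C (f p) e e' = 0;
  (* closure of s(TS) under the bracket of E_S, which is induced by the bracket
     of the extensions of sections to open subsets of N *)
  ct_involutive : forall (W : set N) (e e' : N -> 'cV[R]_(n + n)), open W ->
    smooth_field (@cou_act R n) W e -> smooth_field (@cou_act R n) W e' ->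
    (forall p, W (f p) -> ct_lift s p (e (f p))) ->
    (forall p, W (f p) -> ct_lift s p (e' (f p))) ->
    forall p, W (f p) -> ct_lift s p (bracket C e e' (f p))
}.

Record gc_submanifold (J : N -> 'cV[R]_(n + n) -> 'cV[R]_(n + n))
    (s : S -> 'cV[R]_k -> set 'cV[R]_(n + n)) : Prop := {
  gs_embedding : embedding f;
  gs_trivialization : courant_trivialization s;
  gs_invariant : forall p, J (f p) @` ct_lift s p = ct_lift s p
}.

End Submanifold.

Section Isomorphism.
Context {R : realType} {m n : nat} {M : manifold R m} {N : manifold R n}.

Definition diffeomorphism (f : M -> N) :=
  smooth_map f /\
  exists g : N -> M, [/\ smooth_map g, cancel f g & cancel g f].

Definition graph_map (f : M -> N) (p : M) : prod_manifold M N := (p, f p).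

Record gc_isomorphism (J0 : M -> 'M[R]_(m + m)) (J1 : N -> 'M[R]_(n + n))
    (f : M -> N) (s : M -> 'cV[R]_m -> set 'cV[R]_((m + n) + (m + n))) :
    Prop := {
  gi_source : generalized_complex J0;
  gi_target : generalized_complex J1;
  gi_diffeo : diffeomorphism f;
  gi_submanifold : gc_submanifold (opp_prod_courant M N) (graph_map f)
                     (opp_prod_end J0 J1) s
}.

End Isomorphism.

Section PoissonGC.
Context {R : realType} {n : nat} {M : manifold R n}.

Definition poisson_gc (I Q : M -> 'M[R]_n) (p : M) : 'M[R]_(n + n) :=
  block_mx (I p) (Q p) 0 (- (I p)^T).

(* {(X + xi, X + xi - i_X F)} *)
Definition form_graph (F : M -> 'M[R]_n) (p : M) :
    set 'cV[R]_((n + n) + (n + n)) :=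
  [set e | exists X xi : 'cV[R]_n,
     e = pair_part (col_mx X xi) (col_mx X (xi - F p *m X))].

Definition diagonal_map (p : M) : prod_manifold M M := (p, p).

End PoissonGC.

(* Main.v *)
(** In the chart at a point everything reduces to linear algebra in the values and
    first derivatives of the tensors.

    Integrability of J = [[I, Q], [0, - I^T]]: differentiating J e = i e shows
    that, for sections of the i-eigenbundle with vector parts X1, X2, X3,
    <[e1, e2], e3> is up to a constant the sum of <(D_X1 J) e2, e3> over cyclic
    permutations, so it only depends on values.  Writing (after conjugation)
    X = Z + (i/2) Q xi with Z of type (0,1) and xi of type (1,0), the terms with
    two, one and no Z vanish by the Nijenhuis condition on I, by dbar sigma = 0
    and by [sigma, sigma] = 0 respectively.

    Along the diagonal, the form part of the bracket of two extensions of sections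
    of the graph of F is seen through its pullback, in which only - F X and
    - F Y occur; skewness of F gives isotropy and dF = 0 gives closure under the
    bracket.  Finally, the graph is invariant since I_j - I_i = Q F and its
    transpose I_j^T = I_i^T + F Q, together with I_j^T F = - F I_i, intertwine J_i
    and J_j. *)

From HB Require Import structures.
Require Import Defs.
From mathcomp Require Import all_boot all_order all_algebra complex.
From mathcomp Require Import boolp classical_sets functions reals.
From mathcomp Require Import interval_inference topology normedtype landau derive.
From mathcomp Require Import sesquilinear ring.

Set Implicit Arguments.
Unset Strict Implicit.
Unset Printing Implicit Defensive.

Import GRing.Theory.
Import numFieldNormedType.Exports.

Local Open Scope classical_set_scope.
Local Open Scope ring_scope.

(** * Calculus of matrix-valued functions *)

Section MatrixCalculus.
Context {R : realType}.

(** The hypotheses on I and sigma speak of all local sections, while the linear algebra needs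
    identities at a single point. They are extracted by testing on special sections: fields with
    constant coordinates near p for the Nijenhuis condition, and their images under 1 + i I for the
    dbar condition, because a field of type (0,1) cannot be kept constant when I varies.

    A tensor at q is written in the chart attached to q, which need not depend continuously on q.
    Derivatives therefore refer to the representative in the fixed chart at p, and the Leibniz rule
    holds there because every product in use is equivariant under changes of chart.

    Conjugation is needed because the i-eigenbundle involves forms of type (0,1), on which sigma
    vanishes, whereas the dbar condition concerns Z of type (0,1) and sigma acts on forms of type
    (1,0).

    An extension of a section of the graph is constrained only on the diagonal, so its transversal
    derivatives are arbitrary. They do enter the form part of the bracket, but not its pullback to
    the diagonal, which is all that decides membership in the graph. *)

Lemma sum_continuous (V : topologicalType) (W : normedModType R)
    (I : finType) (f : I -> V -> W) :
  (forall i, continuous (f i)) -> continuous (fun x => \sum_i f i x).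
Proof.
move=> fc; apply: (continuous_big (op := +%R)) => [|i _]; last exact: fc.
exact: add_continuous.
Qed.

Lemma mx_linear_continuous m n (W : normedModType R)
    (f : {linear 'M[R]_(m, n) -> W}) : continuous f.
Proof.
rewrite (_ : (f : _ -> _) =
    fun A => \sum_(ij : 'I_m * 'I_n) A ij.1 ij.2 *: f (delta_mx ij.1 ij.2)).
  apply: sum_continuous => -[i j] A /=.
  by apply: (@cvgZr_tmp _ _ _ (nbhs A)); exact: coord_continuous.
apply/funext => A; rewrite {1}[A]matrix_sum_delta pair_bigA raddf_sum.
by apply: eq_bigr => ij _ /=; rewrite linearZ_LR.
Qed.

Lemma mulmx_continuous m n p :
  continuous (fun AB : 'M[R]_(m, n) * 'M[R]_(n, p) => AB.1 *m AB.2).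
Proof.
rewrite (_ : (fun _ => _) = fun AB : 'M[R]_(m, n) * 'M[R]_(n, p) =>
    \sum_(ik : 'I_m * 'I_p) \sum_j
      (AB.1 ik.1 j * AB.2 j ik.2) *: delta_mx ik.1 ik.2).
  apply: sum_continuous => -[i k]; apply: sum_continuous => j [A B] /=.
  apply: (@cvgZr_tmp _ _ _ (nbhs (A, B))).
  apply: (@cvgM _ _ (nbhs (A, B)) _ (fun AB => AB.1 i j) (fun AB => AB.2 j k)).
    apply: (@cvg_comp _ _ _ fst (fun A' : 'M_(m, n) => A' i j) _ (nbhs A)).
      exact: cvg_fst.
    exact: coord_continuous.
  apply: (@cvg_comp _ _ _ snd (fun A' : 'M_(n, p) => A' j k) _ (nbhs B)).
    exact: cvg_snd.
  exact: coord_continuous.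
apply/funext => -[A B] /=; rewrite {1}[A *m B]matrix_sum_delta pair_bigA /=.
by apply: eq_bigr => ij _; rewrite mxE scaler_suml.
Qed.

(** Level k+1 of [Ck] mentions only differentiability and the derivatives, so losing one order takes
    an induction, with continuity of differentiable maps at the bottom. Product and chain rules need
    it for the factor that is not differentiated. *)
Lemma CkW (V W : normedModType R) k (A : set V) (f : V -> W) :
  Ck k.+1 A f -> Ck k A f.
Proof.
elim: k f => [|k IH] f [df Df]; first by move=> x /df /differentiable_continuous.
by split=> // v; apply: IH.
Qed.

Section Linear.
Context {V : normedModType R} {m n p q : nat}.
Variables (L : 'M[R]_(m, n) -> 'M[R]_(p, q)) (linL : linear L).

Let L' : {linear 'M[R]_(m, n) -> 'M[R]_(p, q)} :=
  HB.pack L (GRing.isLinear.Build _ _ _ _ L linL).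

Lemma Ck_lin k (A : set V) (f : V -> 'M[R]_(m, n)) :
  open A -> Ck k A f -> Ck k A (fun x => L (f x)).
Proof.
by move=> oA; apply: (Ck_linear_comp (L := L') oA); exact: mx_linear_continuous.
Qed.

Lemma smooth_on_lin (A : set V) (f : V -> 'M[R]_(m, n)) :
  open A -> smooth_on A f -> smooth_on A (fun x => L (f x)).
Proof. by move=> oA sf k; exact: Ck_lin. Qed.

Lemma derive_lin (f : V -> 'M[R]_(m, n)) x v : differentiable f x ->
  'D_v (fun y => L (f y)) x = L ('D_v f x).
Proof.
by move=> df; apply: (derive_linear_comp (L := L')) => //; exact: mx_linear_continuous.
Qed.

Lemma differentiable_lin (f : V -> 'M[R]_(m, n)) x : differentiable f x ->
  differentiable (fun y => L (f y)) x.
Proof.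
move=> df; apply: (differentiable_comp (g := L')) => //.
by apply: linear_differentiable; exact: mx_linear_continuous.
Qed.

End Linear.

Lemma mulmx_differentiable m n p (x : 'M[R]_(m, n) * 'M[R]_(n, p)) :
  differentiable (fun AB => AB.1 *m AB.2) x.
Proof.
apply: (@differentiable_bilin _ _ _ _ (mulmx : {bilinear _ -> _ -> _})).
exact: mulmx_continuous.
Qed.

Lemma diff_mulmx m n p (x : 'M[R]_(m, n) * 'M[R]_(n, p)) :
  'd (fun AB => AB.1 *m AB.2) x = (fun AB => x.1 *m AB.2 + AB.1 *m x.2) :> (_ -> _).
Proof.
rewrite (@diff_bilin _ _ _ _ (mulmx : {bilinear _ -> _ -> _})) //.
exact: mulmx_continuous.
Qed.

Section Product.
Context {V : normedModType R} {m n p : nat}.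
Implicit Types (f : V -> 'M[R]_(m, n)) (g : V -> 'M[R]_(n, p)).

Lemma differentiable_mulmx f g x : differentiable f x -> differentiable g x ->
  differentiable (fun y => f y *m g y) x.
Proof.
move=> df dg.
apply: (differentiable_comp (f := fun y => (f y, g y))
  (g := fun AB : 'M[R]_(m, n) * 'M[R]_(n, p) => AB.1 *m AB.2)).
  exact: differentiable_pair.
exact: mulmx_differentiable.
Qed.

Lemma derive_mulmx f g x v : differentiable f x -> differentiable g x ->
  'D_v (fun y => f y *m g y) x = 'D_v f x *m g x + f x *m 'D_v g x.
Proof.
move=> df dg; rewrite !deriveE //; last exact: differentiable_mulmx.
rewrite (diff_comp (f := fun y => (f y, g y))
  (g := fun AB : 'M[R]_(m, n) * 'M[R]_(n, p) => AB.1 *m AB.2)) //; first last.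
- exact: mulmx_differentiable.
- exact: differentiable_pair.
rewrite /= diff_pair // diff_mulmx /=.
by rewrite addrC.
Qed.

Lemma Ck_mulmx k (A : set V) f g : open A ->
  Ck k A f -> Ck k A g -> Ck k A (fun y => f y *m g y).
Proof.
move=> oA; elim: k f g => [|k IH] f g /=.
  move=> fc gc x Ax.
  apply: (@cvg_comp _ _ _ (fun y => (f y, g y))
     (fun AB : 'M[R]_(m, n) * 'M[R]_(n, p) => AB.1 *m AB.2) _ _ _
     (cvg_pair (fc x Ax) (gc x Ax))).
  exact: (@mulmx_continuous m n p (f x, g x)).
move=> /[dup] /CkW fk [df Df] /[dup] /CkW gk [dg Dg]; split=> [x Ax|v].
  by apply: differentiable_mulmx; [exact: df|exact: dg].
apply: (@Ck_ext _ _ _ k A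
    ((fun y => 'D_v f y *m g y) + (fun y => f y *m 'D_v g y))) => //.
  by move=> x Ax; rewrite derive_mulmx; [|exact: df|exact: dg].
by apply: Ck_add => //; apply: IH.
Qed.

Lemma smooth_on_mulmx (A : set V) f g : open A ->
  smooth_on A f -> smooth_on A g -> smooth_on A (fun y => f y *m g y).
Proof. by move=> oA sf sg k; exact: Ck_mulmx. Qed.

End Product.

Lemma smooth_on_differentiable (V W : normedModType R) (A : set V) (f : V -> W) x :
  smooth_on A f -> A x -> differentiable f x.
Proof. by move=> /(_ 1%N) [df _]; exact: df. Qed.

Lemma smooth_on_derive (V W : normedModType R) (A : set V) (f : V -> W) v :
  smooth_on A f -> smooth_on A ('D_v f).
Proof. by move=> sf k; have [_] := sf k.+1; apply. Qed.

Lemma smooth_on_ext (V W : normedModType R) (A : set V) (f g : V -> W) :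
  open A -> (forall x, A x -> f x = g x) -> smooth_on A f -> smooth_on A g.
Proof. by move=> oA fg sf k; apply: Ck_ext (sf k). Qed.

Lemma smooth_on_subset (V W : normedModType R) (A B : set V) (f : V -> W) :
  A `<=` B -> smooth_on B f -> smooth_on A f.
Proof. by move=> AB sf k; apply: Ck_subset (sf k). Qed.

Lemma smooth_on_add (V W : normedModType R) (A : set V) (f g : V -> W) :
  open A -> smooth_on A f -> smooth_on A g -> smooth_on A (fun x => f x + g x).
Proof. by move=> oA sf sg k; apply: Ck_add. Qed.

Lemma Ck_sum (V W : normedModType R) (I : finType) k (A : set V) (f : I -> V -> W) :
  open A -> Ck k A (cst 0 : V -> W) -> (forall i, Ck k A (f i)) ->
  Ck k A (fun x => \sum_i f i x).
Proof.
move=> oA c0 fk; rewrite (_ : (fun _ => _) = \sum_i f i); last first.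
  by apply/funext => x; rewrite fct_sumE.
elim/big_ind: _ => [//|g h gk hk|//]; exact: Ck_add oA gk hk.
Qed.

Lemma Ck_cst (V W : normedModType R) k (A : set V) (c : W) : Ck k A (cst c).
Proof.
elim: k c => [|k IH] c /=; first by move=> x _; exact: cst_continuous.
split=> [x _|v]; first exact: differentiable_cst.
rewrite (_ : 'D_v _ = cst 0) //.
by apply/funext => x; rewrite derive_cst.
Qed.

Lemma smooth_on_cst (V W : normedModType R) (A : set V) (c : W) :
  smooth_on A (fun=> c).
Proof. by move=> k; exact: Ck_cst. Qed.

Lemma smooth_on_id (V : normedModType R) (A : set V) : smooth_on A (fun x => x).
Proof.
case=> [|k] /=; first by move=> x _; exact: cvg_id.
split=> [x _|v]; first by [].
rewrite (_ : 'D_v _ = cst v); first exact: Ck_cst.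
by apply/funext => x; rewrite derive_id.
Qed.

Lemma derive_sum_delta m p q (f : 'cV[R]_m -> 'M[R]_(p, q)) x v :
  differentiable f x ->
  'D_v f x = \sum_j v j 0 *: 'D_(delta_mx j 0) f x.
Proof.
move=> df; rewrite deriveE // {1}[v]matrix_sum_delta.
rewrite raddf_sum /=; apply: eq_bigr => j _.
by rewrite big_ord1 linearZ_LR deriveE.
Qed.

Lemma derive_chain (U V W : normedModType R) (g : U -> V) (f : V -> W) x v :
  differentiable g x -> differentiable f (g x) ->
  'D_v (fun y => f (g y)) x = 'D_('D_v g x) f (g x).
Proof.
move=> dg df; rewrite (deriveE v (differentiable_comp dg df)) (deriveE _ df).
by rewrite (diff_comp dg df) (deriveE v dg).
Qed.

Lemma Ck_comp m n p q k (A : set 'cV[R]_m) (B : set 'cV[R]_n)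
    (g : 'cV[R]_m -> 'cV[R]_n) (f : 'cV[R]_n -> 'M[R]_(p, q)) :
  open A -> (forall x, A x -> B (g x)) -> Ck k B f -> Ck k A g ->
  Ck k A (fun x => f (g x)).
Proof.
move=> oA AB; elim: k f => [|k IH] f /=.
  by move=> fc gc x Ax; apply: continuous_comp; [exact: gc|exact/fc/AB].
move=> [df Df] /[dup] gk [dg Dg]; split=> [x Ax|v].
  by apply: (differentiable_comp (f := g)); [exact: dg|exact/df/AB].
have gk' := CkW gk.
(* The chain rule gives a derivative of f in the direction ['D_v g x], which moves with x. Expanding
   it in fixed coordinate directions makes the induction hypothesis applicable. *)
apply: (@Ck_ext _ _ _ k A (fun x => \sum_j
    ('D_v g x) j 0 *: 'D_(delta_mx j 0) f (g x))) => //.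
  move=> x Ax; have dfx := df _ (AB x Ax); have dgx := dg _ Ax.
  by rewrite (derive_chain _ dgx dfx) (derive_sum_delta _ dfx).
apply: Ck_sum => // [|j]; first exact: Ck_cst.
apply: (@Ck_ext _ _ _ k A (fun x => ('D_v g x j 0)%:M *m 'D_(delta_mx j 0) f (g x))) => //.
  by move=> x _; rewrite mul_scalar_mx.
apply: Ck_mulmx => //; last exact: IH (Df _) gk'.
apply: (@Ck_lin _ _ _ _ _ (fun u : 'cV[R]_n => (u j 0)%:M)) => //.
by move=> a u w; rewrite !mxE raddfD /= scale_scalar_mx.
Qed.

Lemma smooth_on_comp m n p q (A : set 'cV[R]_m) (B : set 'cV[R]_n)
    (g : 'cV[R]_m -> 'cV[R]_n) (f : 'cV[R]_n -> 'M[R]_(p, q)) :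
  open A -> (forall x, A x -> B (g x)) -> smooth_on B f -> smooth_on A g ->
  smooth_on A (fun x => f (g x)).
Proof. by move=> oA AB sf sg k; apply: Ck_comp AB (sf k) (sg k). Qed.

End MatrixCalculus.

(** * Charts and transition matrices *)

Section Jacobian.
Context {R : realType}.

Lemma mulmx_cV_inj (K : pzSemiRingType) m n (A B : 'M[K]_(m, n)) :
  (forall v : 'cV_n, A *m v = B *m v) -> A = B.
Proof.
move=> AB; apply/matrixP => i j; have := AB (delta_mx j 0).
by rewrite -!colE => /colP /(_ i); rewrite !mxE.
Qed.

Lemma derive_addf (V W : normedModType R) (f g : V -> W) x v :
  differentiable f x -> differentiable g x ->
  'D_v (fun y => f y + g y) x = 'D_v f x + 'D_v g x.
Proof.
by move=> df dg; rewrite (@deriveD _ _ _ f g) //; exact: diff_derivable.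
Qed.

Section ColMx.
Context {V : normedModType R} {m1 m2 p : nat}.
Implicit Types (f : V -> 'M[R]_(m1, p)) (g : V -> 'M[R]_(m2, p)).

Let inl_linear : linear (fun A : 'M[R]_(m1, p) => col_mx A 0 : 'M_(m1 + m2, p)).
Proof. by move=> a u v; rewrite scale_col_mx add_col_mx scaler0 addr0. Qed.

Let inr_linear : linear (fun A : 'M[R]_(m2, p) => col_mx 0 A : 'M_(m1 + m2, p)).
Proof. by move=> a u v; rewrite scale_col_mx add_col_mx scaler0 addr0. Qed.

Let split f g : (fun x => col_mx (f x) (g x)) =
  (fun x => col_mx (f x) 0 + col_mx 0 (g x)).
Proof. by apply/funext => x; rewrite add_col_mx addr0 add0r. Qed.

Lemma differentiable_col_mx f g x : differentiable f x -> differentiable g x ->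
  differentiable (fun y => col_mx (f y) (g y)) x.
Proof.
move=> df dg; rewrite split; apply: differentiableD.
  exact: (differentiable_lin inl_linear).
exact: (differentiable_lin inr_linear).
Qed.

Lemma derive_col_mx f g x v : differentiable f x -> differentiable g x ->
  'D_v (fun y => col_mx (f y) (g y)) x = col_mx ('D_v f x) ('D_v g x).
Proof.
move=> df dg; rewrite split derive_addf.
- by rewrite (derive_lin inl_linear) // (derive_lin inr_linear) // add_col_mx addr0 add0r.
- exact: (differentiable_lin inl_linear).
- exact: (differentiable_lin inr_linear).
Qed.

Lemma smooth_on_col_mx_pair (A : set V) f g : open A -> smooth_on A f ->
  smooth_on A g -> smooth_on A (fun x => col_mx (f x) (g x)).
Proof.
move=> oA sf sg; rewrite split; apply: smooth_on_add => //.
  exact: (smooth_on_lin inl_linear).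
exact: (smooth_on_lin inr_linear).
Qed.

End ColMx.

Lemma jacM m n (f : 'cV[R]_n -> 'cV[R]_m) x v : differentiable f x ->
  jac f x *m v = 'D_v f x.
Proof.
move=> df; rewrite (derive_sum_delta _ df); apply/colP => i.
by rewrite !mxE summxE; apply: eq_bigr => j _; rewrite !mxE mulrC.
Qed.

Lemma jac_comp m n p (f : 'cV[R]_n -> 'cV[R]_m) (g : 'cV[R]_p -> 'cV[R]_n) x :
  differentiable g x -> differentiable f (g x) ->
  jac (fun y => f (g y)) x = jac f (g x) *m jac g x.
Proof.
move=> dg df; apply: mulmx_cV_inj => v.
rewrite -mulmxA (jacM _ dg) (jacM _ df) (jacM _ (differentiable_comp dg df)).
exact: derive_chain.
Qed.

Lemma derive_diag n p q (f : 'cV[R]_(n + n) -> 'M[R]_(p, q)) x u :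
  differentiable f (col_mx x x) ->
  'D_u (fun y => f (col_mx y y)) x = 'D_(col_mx u u) f (col_mx x x).
Proof.
have l : linear (fun x : 'cV[R]_n => col_mx x x).
  by move=> a v w; rewrite scale_col_mx add_col_mx.
have dl : differentiable (fun x : 'cV[R]_n => col_mx x x) x.
  exact: (differentiable_lin (f := id) l).
move=> df; rewrite (derive_chain (g := fun y => col_mx y y) u dl df).
have did : differentiable (fun y : 'cV[R]_n => y) x by [].
by rewrite (derive_lin l u did) derive_id.
Qed.

Lemma near_eq_jac m n (f g : 'cV[R]_n -> 'cV[R]_m) x :
  (\near x, f x = g x) -> jac f x = jac g x.
Proof.
by move=> fg; apply/matrixP => i j; rewrite !mxE (near_eq_derive _ fg).
Qed.

Lemma jac_lin m n (f : 'cV[R]_n -> 'cV[R]_m) x v : linear f ->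
  jac f x *m v = f v.
Proof.
move=> lf; rewrite jacM; last first.
  by apply: (@differentiable_lin _ _ _ _ _ _ f lf id).
by rewrite (derive_lin (f := id) lf) // derive_id.
Qed.

End Jacobian.

Section Charts.
Context {R : realType} {n : nat} {M : manifold R n}.
Implicit Types (p q r s : M) (W : set M).

Local Notation phi p := (chart_fun (chart_at p)).
Local Notation phiV p := (chart_inv (chart_at p)).
Local Notation dom p := (chart_dom (chart_at p)).

(** [transition p q] is the case r = q. The cocycle rule needs the Jacobian at a point to which
    neither chart is attached. *)
Definition coord_change p q r : 'M[R]_n := jac (phi p \o phiV q) (phi q r).

Lemma open_chart_image W p : open W -> open (phi p @` (W `&` dom p)).
Proof.
move=> oW.
rewrite (_ : _ @` _ = (phi p @` dom p) `&` (phiV p @^-1` W)).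
  rewrite openE => x [cx dx].
  apply: filterI; first by apply: open_nbhs_nbhs; split => //; exact: open_chart_codom.
  by apply: (chart_inv_continuous cx); exact: open_nbhs_nbhs.
apply/seteqP; split => [_ [q [Wq dq] <-]|_ [[q dq <-]]] /=.
  by split; [exists q|rewrite chart_funK ?inE].
by rewrite chart_funK ?inE// => Wq; exists q.
Qed.

Lemma chart_imageP W p x : (phi p @` (W `&` dom p)) x ->
  [/\ W (phiV p x), dom p (phiV p x) & phi p (phiV p x) = x].
Proof. by move=> [q [Wq dq] <-]; rewrite chart_funK ?inE. Qed.

Lemma near_chart W p : open W -> W p -> \forall x \near phi p p,
  (phi p @` (W `&` dom p)) x.
Proof.
move=> oW Wp; apply: open_nbhs_nbhs; split; first exact: open_chart_image.
by exists p => //; split => //; exact: dom_chart_at.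
Qed.

Lemma coord_change_differentiable p q r : dom p r -> dom q r ->
  differentiable (phi p \o phiV q) (phi q r).
Proof.
move=> pr qr; apply: (smooth_on_differentiable (@chart_compat _ _ M q p)).
by exists r.
Qed.

Lemma near_chart_at p r : dom p r -> \forall x \near phi p r,
  dom p (phiV p x) /\ phi p (phiV p x) = x.
Proof.
move=> pr; have /open_nbhs_nbhs : open_nbhs (phi p r) (phi p @` (setT `&` dom p)).
  by split; [apply: open_chart_image; exact: openT|exists r].
by apply: filterS => x /chart_imageP[].
Qed.

Lemma coord_change_id p r : dom p r -> coord_change p p r = 1%:M.
Proof.
move=> pr; rewrite /coord_change.
rewrite (@near_eq_jac _ _ _ _ id); last first.
  by apply: filterS (near_chart_at pr) => x [].
by apply: mulmx_cV_inj => v; rewrite mul1mx jac_lin.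
Qed.

Lemma coord_changeM p q s r : dom p r -> dom q r -> dom s r ->
  coord_change p q r *m coord_change q s r = coord_change p s r.
Proof.
move=> pr qr sr; rewrite /coord_change.
have e : phi q r = (phi q \o phiV s) (phi s r) by rewrite /= chart_funK ?inE.
rewrite {1}e -jac_comp; first last.
- by rewrite -e; exact: coord_change_differentiable.
- exact: coord_change_differentiable.
apply: near_eq_jac => /=.
have oV : open (dom q `&` dom p) by apply: openI; exact: open_chart_dom.
have : open_nbhs (phi s r) (phi s @` ((dom q `&` dom p) `&` dom s)).
  by split; [exact: open_chart_image|exists r].
move=> /open_nbhs_nbhs; apply: filterS => x /chart_imageP[[qx px] sx _].
by rewrite /= [phiV q _]chart_funK ?inE.
Qed.

Lemma transition_id p : transition p p = 1%:M.
Proof. exact/coord_change_id/dom_chart_at. Qed.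

Lemma coord_changeV p q r : dom p r -> dom q r ->
  coord_change p q r *m coord_change q p r = 1%:M.
Proof. by move=> pr qr; rewrite coord_changeM // coord_change_id. Qed.

Lemma coord_change_unit p q r : dom p r -> dom q r ->
  coord_change p q r \in unitmx.
Proof.
move=> pr qr. have e := coord_changeV pr qr.
have [u _] := mulmx1_unit e.
exact: u.
Qed.

Lemma coord_change_inv p q r : dom p r -> dom q r ->
  invmx (coord_change p q r) = coord_change q p r.
Proof.
move=> pr qr; have u := coord_change_unit pr qr.
by rewrite -[RHS](mulKmx u) coord_changeV // mulmx1.
Qed.

Lemma transition_unit p q : dom p q -> transition p q \in unitmx.
Proof. by move=> pq; apply: coord_change_unit => //; exact: dom_chart_at. Qed.

Section Field.
Variables (k l : nat) (act : 'M[R]_n -> 'M[R]_(k, l) -> 'M[R]_(k, l)).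
Implicit Type T : M -> 'M[R]_(k, l).

Lemma smooth_field_differentiable W T p : W p -> smooth_field act W T ->
  differentiable (local_rep act T p) (phi p p).
Proof.
move=> Wp sT; apply: (smooth_on_differentiable (sT p)).
by exists p => //; split => //; exact: dom_chart_at.
Qed.

Lemma along_partial T p v : differentiable (local_rep act T p) (phi p p) ->
  along (partial act T p) v = 'D_v (local_rep act T p) (phi p p).
Proof. by move=> dT; rewrite (derive_sum_delta _ dT). Qed.

Lemma local_rep_at T p : local_rep act T p (phi p p) = act 1%:M (T p).
Proof.
by rewrite /local_rep chart_funK ?inE ?transition_id //; exact: dom_chart_at.
Qed.

Lemma smooth_field_subset W W' T : W `<=` W' -> smooth_field act W' T ->
  smooth_field act W T.
Proof.
move=> WW sT p; apply: smooth_on_subset (sT p) => _ [q [Wq dq] <-].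
by exists q => //; split => //; exact: WW.
Qed.

End Field.

(* The vector field with constant components v in the chart at p. *)
Definition frame_field p (v : 'cV[R]_n) (q : M) := invmx (transition p q) *m v.

(** By the cocycle rule, the inverse matrices in [frame_field], each written in a different chart,
    collapse to the Jacobian of one fixed change of charts. This form makes the smoothness of the
    field visible. *)
Lemma local_rep_frame p s v x :
  (phi s @` (dom p `&` dom s)) x ->
  local_rep (@vec_act R n) (frame_field p v) s x =
    'D_v (phi s \o phiV p) (phi p (phiV s x)).
Proof.
move=> /chart_imageP[px sx _]; rewrite /local_rep /vec_act /frame_field /=.
set q := phiV s x in px sx *; have qq := dom_chart_at q.
rewrite [invmx _]coord_change_inv // mulmxA coord_changeM // jacM //.
exact: coord_change_differentiable.
Qed.

Lemma frame_field_smooth p v :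
  smooth_field (@vec_act R n) (dom p) (frame_field p v).
Proof.
move=> s; have oD : open (phi s @` (dom p `&` dom s)).
  by apply: open_chart_image; exact: open_chart_dom.
apply: (@smooth_on_ext _ _ _ _
  (fun x => 'D_v (phi s \o phiV p) ((phi p \o phiV s) x))) => //.
  by move=> x Dx; rewrite local_rep_frame.
apply: (@smooth_on_comp _ _ _ _ _ _ (phi p @` (dom p `&` dom s)) (phi p \o phiV s)
  ('D_v (phi s \o phiV p))) => //.
- by move=> x /chart_imageP[px sx _]; exists (phiV s x).
- by apply: smooth_on_derive; exact: chart_compat.
- by rewrite setIC; exact: chart_compat.
Qed.

Lemma near_local_rep_frame p v : \forall x \near phi p p,
  local_rep (@vec_act R n) (frame_field p v) p x = v.
Proof.
apply: filterS (near_chart_at (dom_chart_at p)) => x [px _].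
by rewrite /local_rep /vec_act mulmxA mulmxV ?mul1mx //; exact: transition_unit.
Qed.

Lemma frame_field_at p v : frame_field p v p = v.
Proof. by rewrite /frame_field transition_id invmx1 mul1mx. Qed.

End Charts.

(** * Linear algebra of the pairing and of the bracket *)

Section Dot.
Context {K : comPzRingType}.

Definition dot n (x y : 'cV[K]_n) : K := (x^T *m y) 0 0.

Section Theory.
Variable n : nat.
Implicit Types x y z : 'cV[K]_n.

Lemma dotC x y : dot x y = dot y x.
Proof. by rewrite /dot -[y^T *m x]trmxK trmx_mul trmxK [RHS]mxE. Qed.

Lemma dotDl x y z : dot (x + y) z = dot x z + dot y z.
Proof. by rewrite /dot linearD /= mulmxDl mxE. Qed.

Lemma dotDr x y z : dot x (y + z) = dot x y + dot x z.
Proof. by rewrite /dot mulmxDr mxE. Qed.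

Lemma dotZl a x y : dot (a *: x) y = a * dot x y.
Proof. by rewrite /dot linearZ /= -scalemxAl mxE. Qed.

Lemma dotZr a x y : dot x (a *: y) = a * dot x y.
Proof. by rewrite /dot -scalemxAr mxE. Qed.

Lemma dotNl x y : dot (- x) y = - dot x y.
Proof. by rewrite -scaleN1r dotZl mulN1r. Qed.

Lemma dotNr x y : dot x (- y) = - dot x y.
Proof. by rewrite -scaleN1r dotZr mulN1r. Qed.

Lemma dot0r x : dot x 0 = 0.
Proof. by rewrite /dot mulmx0 mxE. Qed.

Lemma dot0l x : dot 0 x = 0.
Proof. by rewrite dotC dot0r. Qed.

Lemma dot_trmxl m (A : 'M[K]_(n, m)) (x : 'cV_n) (y : 'cV_m) :
  dot (A^T *m x) y = dot x (A *m y).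
Proof. by rewrite /dot trmx_mul trmxK mulmxA. Qed.

Lemma dot_delta (j : 'I_n) x : dot (delta_mx j 0) x = x j 0.
Proof. by rewrite /dot trmx_delta -rowE mxE. Qed.

Lemma dot_inj x y : (forall z, dot z x = dot z y) -> x = y.
Proof. by move=> xy; apply/colP => j; rewrite -!dot_delta. Qed.

End Theory.

(** [std_pairing] over any commutative ring: on complexified sections it is the bilinear, not the
    Hermitian, extension. *)
Definition cpair n (e e' : 'cV[K]_(n + n)) : K :=
  dot (dsubmx e) (usubmx e') + dot (dsubmx e') (usubmx e).

Section Pair.
Variable n : nat.
Implicit Types e : 'cV[K]_(n + n).

Lemma cpairC e e' : cpair e e' = cpair e' e.
Proof. by rewrite /cpair addrC. Qed.

Lemma cpairDl e e' e'' : cpair (e + e') e'' = cpair e e'' + cpair e' e''.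
Proof. by rewrite /cpair !linearD /= dotDl dotDr addrACA. Qed.

Lemma cpairZl a e e' : cpair (a *: e) e' = a * cpair e e'.
Proof. by rewrite /cpair !linearZ /= dotZl dotZr mulrDr. Qed.

Lemma cpair_inj e e' : (forall f, cpair e f = cpair e' f) -> e = e'.
Proof.
move=> ee; rewrite -[e]vsubmxK -[e']vsubmxK; congr col_mx; apply: dot_inj => z.
  by have := ee (col_mx 0 z); rewrite /cpair col_mxKu col_mxKd !dot0r !add0r.
have := ee (col_mx z 0); rewrite /cpair col_mxKu col_mxKd !dot0l !addr0.
by rewrite dotC => ->; rewrite dotC.
Qed.

(** The Courant bracket in terms of the flat connection D of the coordinates: D is torsion-free and
    preserves the pairing, and the last term accounts for the failure of skew-symmetry. *)
Lemma cpair_bracket (e1 e2 e3 : 'cV[K]_(n + n)) (D1 D2 : 'M[K]_(n + n, n)) :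
  cpair (bracket_formula e1 e2 D1 D2) e3 =
    cpair (D2 *m usubmx e1) e3 - cpair (D1 *m usubmx e2) e3
    + cpair (D1 *m usubmx e3) e2.
Proof.
rewrite /cpair /bracket_formula /= col_mxKu col_mxKd.
rewrite -!mul_usub_mx -!mul_dsub_mx !(dotDl, dotDr, dotNl, dotNr) !dot_trmxl.
rewrite [dot (usubmx e2) _]dotC; ring.
Qed.

End Pair.

(** The matrix of [poisson_gc] over any ring. Being linear in the pair (I, Q), it also describes the
    derivative of J, as [gc_block] of the derivatives. *)
Definition gc_block n (I Q : 'M[K]_n) : 'M[K]_(n + n) := block_mx I Q 0 (- I^T).

Lemma gc_blockM n (I Q : 'M[K]_n) (e : 'cV_(n + n)) :
  gc_block I Q *m e =
  col_mx (I *m usubmx e + Q *m dsubmx e) (- (I^T *m dsubmx e)).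
Proof.
by rewrite -{1}[e]vsubmxK mul_block_col mul0mx add0r mulNmx.
Qed.

Lemma cpair_gc_block n (I Q : 'M[K]_n) e e' :
  cpair (gc_block I Q *m e) e' =
    - dot (dsubmx e) (I *m usubmx e') + dot (dsubmx e') (I *m usubmx e)
    + dot (dsubmx e') (Q *m dsubmx e).
Proof.
by rewrite gc_blockM /cpair col_mxKu col_mxKd dotNl dot_trmxl dotDr addrA.
Qed.

Lemma cpair_gc_block_skew n (I Q : 'M[K]_n) e e' : Q^T = - Q ->
  cpair (gc_block I Q *m e) e' = - cpair e (gc_block I Q *m e').
Proof.
move=> QT; rewrite [cpair e _]cpairC !cpair_gc_block.
have -> : dot (dsubmx e) (Q *m dsubmx e') = - dot (dsubmx e') (Q *m dsubmx e).
  by rewrite -dot_trmxl QT mulNmx dotNl dotC.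
by rewrite !opprD !opprK; congr (_ + _); rewrite addrC.
Qed.

Lemma gc_block_sqr n (I Q : 'M[K]_n) : I *m I = - 1%:M -> I *m Q = Q *m I^T ->
  gc_block I Q *m gc_block I Q = - 1%:M.
Proof.
move=> II IQ; rewrite /gc_block mulmx_block !(mulmx0, mul0mx, addr0, add0r).
rewrite mulmxN IQ subrr mulNmx mulmxN opprK -trmx_mul II [_^T]raddfN /= trmx1.
by rewrite scalar_mx_block opp_block_mx oppr0.
Qed.

Lemma cpair_gc_block_orthogonal n (I Q : 'M[K]_n) e e' :
  I *m I = - 1%:M -> Q^T = - Q -> I *m Q = Q *m I^T ->
  cpair (gc_block I Q *m e) (gc_block I Q *m e') = cpair e e'.
Proof.
move=> II QT IQ; rewrite cpair_gc_block_skew // mulmxA gc_block_sqr //.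
by rewrite mulNmx mul1mx cpairC -scaleN1r cpairZl mulN1r opprK cpairC.
Qed.

(** * Bracket of sections of the graph over the diagonal *)

Section GraphBracket.
Variables (n : nat) (F : 'M[K]_n) (dF : 'cV[K]_n -> 'M[K]_n).
Hypothesis FT : F^T = - F.
Hypothesis closedF : forall x y w : 'cV[K]_n,
  dot w (dF x *m y) - dot w (dF y *m x) + dot y (dF w *m x) = 0.

(** The graph of F after [flip], whence the sign of the first covector. *)
Let graph (x xi : 'cV[K]_n) : 'cV[K]_((n + n) + (n + n)) :=
  col_mx (col_mx x x) (col_mx (- xi) (xi - F *m x)).

(** All that is known about the Jacobian matrix D of an extension: its values on directions (u, u),
    obtained by differentiating the graph equation along the diagonal. *)
Let graph_derivative (x : 'cV[K]_n) (D : 'M[K]_((n + n) + (n + n), n + n)) :=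
  forall u, exists x' xi', D *m col_mx u u =
    col_mx (col_mx x' x') (col_mx (- xi') (xi' - (dF u *m x + F *m x'))).

Let dot_col (a b c d : 'cV[K]_n) : dot (col_mx a b) (col_mx c d) = dot a c + dot b d.
Proof. by rewrite /dot tr_col_mx mul_row_col mxE. Qed.

(* In the form part only the sum of the two components, i.e. the pullback of
   the 1-form to the diagonal, matters. *)
Lemma graph_bracket x xi y eta D1 D2 :
  graph_derivative x D1 -> graph_derivative y D2 ->
  exists z c, bracket_formula (graph x xi) (graph y eta) D1 D2 =
    col_mx (col_mx z z) (col_mx c (- (F *m z) - c)).
Proof.
move=> H1 H2; have [y' [eta' Dx]] := H2 x; have [x' [xi' Dy]] := H1 y.
set B := bracket_formula _ _ _ _.
have uB : usubmx B = col_mx (y' - x') (y' - x').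
  rewrite /B /bracket_formula /= col_mxKu /graph !col_mxKu !mul_usub_mx Dx Dy.
  by rewrite !col_mxKu opp_col_mx add_col_mx.
exists (y' - x'), (usubmx (dsubmx B)).
rewrite -[LHS]vsubmxK uB -[dsubmx B in LHS]vsubmxK; congr (col_mx _ (col_mx _ _)).
apply/eqP; rewrite -subr_eq0 opprD !opprK addrCA; apply/eqP.
apply: dot_inj => w; have [w' [zeta Dw]] := H1 w; rewrite dot0r.
(* Evaluating the form part on the tangent vector (w, w) is its pullback. In this pairing
   [cpair_bracket] uses [D1] and [D2] only in the directions (x, x), (y, y) and (w, w). *)
have E : dot w (dsubmx (dsubmx B) + usubmx (dsubmx B)) = cpair B (col_mx (col_mx w w) 0).
  rewrite /cpair col_mxKu col_mxKd dot0l addr0 -[dsubmx B in RHS]vsubmxK dot_col.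
  by rewrite addrC dotDr ![dot w _]dotC.
rewrite dotDr E cpair_bracket /graph !col_mxKu Dx Dy Dw.
rewrite /cpair !(col_mxKu, col_mxKd) !dot0l !addr0 !dot_col -!dotDl !addrA !addNr !add0r.
rewrite mulmxBr !(dotDl, dotNl, dotDr, dotNr).
have -> : dot (F *m y) w' = - dot (F *m w') y.
  by rewrite -[F *m y]opprK -mulNmx -FT dotNl dot_trmxl dotC.
have := closedF x y w.
rewrite ![dot w _]dotC ![dot y _]dotC => H.
by rewrite -[RHS]oppr0 -[in RHS]H; ring.
Qed.

End GraphBracket.

End Dot.

(** * Eigenbundles and the integrability tensor *)

Section Eigen.
Context {K : fieldType} (i : K) (ii : i * i = - 1) (nz2 : 2%:R != 0 :> K).
Variable n : nat.

Let nzi : i != 0.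
Proof.
apply/eqP => i0; have /eqP := ii; rewrite i0 mul0r eq_sym oppr_eq0.
by rewrite oner_eq0.
Qed.

Lemma eq_opp_imag (x : K) : i * x = - (i * x) -> x = 0.
Proof.
move=> /eqP; rewrite -addr_eq0 -mulr2n -mulr_natl !mulf_eq0 (negbTE nz2).
by rewrite (negbTE nzi) => /eqP.
Qed.

(* Differentiating J e = i e gives (J - i) De = - DJ e, and the skewness of J
   turns (J - i) into - 2i when paired with the i-eigenspace. *)
Lemma cpair_derive (I Q : 'M[K]_n) (e' De DJe : 'cV[K]_(n + n)) :
  Q^T = - Q -> gc_block I Q *m e' = i *: e' ->
  DJe + gc_block I Q *m De = i *: De ->
  (2%:R * i) * cpair De e' = cpair DJe e'.
Proof.
move=> QT Je' /(congr1 (fun f => @cpair K n f e')).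
rewrite cpairDl cpair_gc_block_skew // Je' [cpair De (_ *: _)]cpairC !cpairZl.
by rewrite [cpair e' De]cpairC => /eqP; rewrite subr_eq => /eqP ->; ring.
Qed.

(** The i-eigenspace is its own orthogonal complement, so it suffices that the bracket pairs to zero
    with every e3 in it. After multiplication by 2 i, [cpair_derive] replaces each derivative of a
    section by the derivative of J, which leaves the tensor of the last hypothesis. *)
Lemma bracket_eigen (I Q : 'M[K]_n) (dI dQ : 'cV[K]_n -> 'M[K]_n)
    (e1 e2 : 'cV[K]_(n + n)) (D1 D2 : 'M[K]_(n + n, n)) :
  I *m I = - 1%:M -> Q^T = - Q -> I *m Q = Q *m I^T ->
  gc_block I Q *m e1 = i *: e1 -> gc_block I Q *m e2 = i *: e2 ->
  (forall v, gc_block (dI v) (dQ v) *m e1 + gc_block I Q *m (D1 *m v)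
             = i *: (D1 *m v)) ->
  (forall v, gc_block (dI v) (dQ v) *m e2 + gc_block I Q *m (D2 *m v)
             = i *: (D2 *m v)) ->
  (forall e3, gc_block I Q *m e3 = i *: e3 ->
     cpair (gc_block (dI (usubmx e1)) (dQ (usubmx e1)) *m e2) e3
     - cpair (gc_block (dI (usubmx e2)) (dQ (usubmx e2)) *m e1) e3
     + cpair (gc_block (dI (usubmx e3)) (dQ (usubmx e3)) *m e1) e2 = 0) ->
  gc_block I Q *m bracket_formula e1 e2 D1 D2
  = i *: bracket_formula e1 e2 D1 D2.
Proof.
move=> II QT IQ J1 J2 H1 H2 H; set B := bracket_formula _ _ _ _.
have JJ (e : 'cV[K]_(n + n)) : gc_block I Q *m (gc_block I Q *m e) = - e.
  by rewrite mulmxA gc_block_sqr // mulNmx mul1mx.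
have B0 e3 : gc_block I Q *m e3 = i *: e3 -> cpair B e3 = 0.
  move=> J3; apply: (mulfI (mulf_neq0 nz2 nzi)); rewrite mulr0 -[RHS](H _ J3).
  rewrite cpair_bracket mulrDr mulrBr.
  rewrite -(cpair_derive QT J3 (H2 _)) -(cpair_derive QT J3 (H1 _)).
  by rewrite -(cpair_derive QT J2 (H1 _)).
apply: cpair_inj => f; rewrite cpairZl.
(* Since J squares to -1, i f + J f is an i-eigenvector for every f. Skewness of J then moves J from
   f to the bracket. *)
have := B0 (i *: f + gc_block I Q *m f); rewrite mulmxDr JJ -scalemxAr.
rewrite scalerDr scalerA ii scaleN1r addrC => /(_ erefl).
rewrite cpairC cpairDl cpairZl [cpair f B]cpairC cpair_gc_block_skew //.
by rewrite [cpair f _]cpairC => /eqP; rewrite subr_eq0 => /eqP.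
Qed.

Section Tensor.
Variables (I Q : 'M[K]_n) (dI dQ : 'cV[K]_n -> 'M[K]_n).
Hypotheses (dID : forall u v, dI (u + v) = dI u + dI v)
  (dIZ : forall a v, dI (a *: v) = a *: dI v)
  (dQD : forall u v, dQ (u + v) = dQ u + dQ v)
  (dQZ : forall a v, dQ (a *: v) = a *: dQ v).
Hypotheses (IQ : I *m Q = Q *m I^T)
  (dII : forall v, dI v *m I = - (I *m dI v)) (dQT : forall v, (dQ v)^T = - dQ v).

(** On forms x with I^T x = i x one has I Q x = i Q x, so I X + Q x = - i X with X = Z + h Q x and I
    Z = - i Z amounts to 2 i h = -1 on Q x. *)
Let h := i * 2%:R^-1.

(** The derivative of I anticommutes with I and so exchanges types: Q y is of type (1,0), its image
    is of type (0,1), and x annihilates it. *)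
Lemma dI_type10 v x y : I^T *m x = i *: x -> I^T *m y = i *: y ->
  dot x (dI v *m (Q *m y)) = 0.
Proof.
move=> tx ty; apply: eq_opp_imag.
rewrite -[LHS]dotZl -tx dot_trmxl [I *m _]mulmxA -[I *m dI v]opprK -dII.
rewrite mulNmx dotNr -!mulmxA [I *m (Q *m y)]mulmxA IQ -mulmxA ty.
by rewrite -!scalemxAr dotZr.
Qed.

(* The three hypotheses are the (2,1)-, (1,2)- and (0,3)-components (counting
   vectors and 1-forms) of the tensor measuring the integrability of J. *)
Lemma gc_tensor0 :
  (forall Z W, I *m Z = - i *: Z -> I *m W = - i *: W ->
     forall x, I^T *m x = i *: x -> dot x (dI Z *m W) = dot x (dI W *m Z)) ->
  (forall Z x y, I *m Z = - i *: Z -> I^T *m x = i *: x -> I^T *m y = i *: y ->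
     dot x (dQ Z *m y) =
     h * (dot x (dI (Q *m y) *m Z) - dot y (dI (Q *m x) *m Z))) ->
  (forall x y z, I^T *m x = i *: x -> I^T *m y = i *: y -> I^T *m z = i *: z ->
     dot x (dQ (Q *m y) *m z) + dot y (dQ (Q *m z) *m x)
     + dot z (dQ (Q *m x) *m y) = 0) ->
  forall e1 e2 e3, gc_block I Q *m e1 = - i *: e1 ->
    gc_block I Q *m e2 = - i *: e2 -> gc_block I Q *m e3 = - i *: e3 ->
    cpair (gc_block (dI (usubmx e1)) (dQ (usubmx e1)) *m e2) e3
    - cpair (gc_block (dI (usubmx e2)) (dQ (usubmx e2)) *m e1) e3
    + cpair (gc_block (dI (usubmx e3)) (dQ (usubmx e3)) *m e1) e2 = 0.
Proof.
move=> HZZ HZ HQ.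
have dec (e : 'cV_(n + n)) : gc_block I Q *m e = - i *: e ->
    I^T *m dsubmx e = i *: dsubmx e /\
    exists2 Z, I *m Z = - i *: Z & usubmx e = Z + h *: (Q *m dsubmx e).
  rewrite gc_blockM -[in RHS](vsubmxK e) scale_col_mx => /eq_col_mx[eX ex].
  have {}ex : I^T *m dsubmx e = i *: dsubmx e.
    by apply: oppr_inj; rewrite ex scaleNr.
  split=> //; exists (usubmx e - h *: (Q *m dsubmx e)); last by rewrite subrK.
  rewrite mulmxBr -scalemxAr mulmxA IQ -mulmxA ex -scalemxAr scalerBr !scalerA.
  rewrite mulNr.
  have -> : h * i = - 2%:R^-1 by rewrite /h mulrAC ii mulN1r.
  have -> : i * h = - 2%:R^-1 by rewrite /h mulrA ii mulN1r.
  move: eX; set a := I *m _; set b := Q *m _ => eX.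
  rewrite -eX opprK scaleNr opprK.
  rewrite -addrA; congr (_ + _).
  by rewrite -{2}[b]scale1r -scalerBl; congr (_ *: _); field.
move=> e1 e2 e3 /dec[t1 [Z1 tZ1 E1]] /dec[t2 [Z2 tZ2 E2]] /dec[t3 [Z3 tZ3 E3]].
rewrite !cpair_gc_block E1 E2 E3 !(dID, dIZ, dQD, dQZ).
rewrite !(mulmxDl, mulmxDr, dotDr, dotDl) -!scalemxAl -!scalemxAr !dotZr.
(* The terms where dI is applied to some Q x disappear; each remaining one is covered by one of the
   three hypotheses. *)
rewrite !dI_type10 //.
set x1 := dsubmx e1 in t1 *; set x2 := dsubmx e2 in t2 *.
set x3 := dsubmx e3 in t3 *.
have skew x y v : dot x (dQ v *m y) = - dot y (dQ v *m x).
  by rewrite -dot_trmxl dQT mulNmx dotNl dotC.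
rewrite (HZ Z1 x3 x2) // (HZ Z2 x3 x1) // (HZ Z3 x2 x1) //.
rewrite (HZZ Z1 Z2 tZ1 tZ2 x3 t3) (HZZ Z1 Z3 tZ1 tZ3 x2 t2) (HZZ Z2 Z3 tZ2 tZ3 x1 t1).
have := HQ x1 x2 x3 t1 t2 t3.
rewrite (skew x3 x1 (Q *m x2)) => /eqP; rewrite -addrA addr_eq0 => /eqP ->.
rewrite (skew x3 x2).
ring.
Qed.

End Tensor.

End Eigen.

(** * Partial derivatives of tensor fields *)

Lemma std_pairingE (R : realType) n (e e' : 'cV[R]_(n + n)) :
  std_pairing e e' = cpair e e'.
Proof. by rewrite /std_pairing mxE. Qed.

Section Actions.
Context {R : realType} {n : nat}.
Implicit Types (A I P F : 'M[R]_n) (X : 'cV[R]_n) (e : 'cV[R]_(n + n)).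

Lemma vec_act1 X : vec_act 1%:M X = X.
Proof. by rewrite /vec_act mul1mx. Qed.

Lemma end_act1 I : end_act 1%:M I = I.
Proof. by rewrite /end_act invmx1 mulmx1 mul1mx. Qed.

Lemma biv_act1 P : biv_act 1%:M P = P.
Proof. by rewrite /biv_act trmx1 mulmx1 mul1mx. Qed.

Lemma form_act1 F : form_act 1%:M F = F.
Proof. by rewrite /form_act invmx1 trmx1 mulmx1 mul1mx. Qed.

Lemma cou_mx1 : cou_mx 1%:M = 1%:M :> 'M[R]_(n + n).
Proof. by rewrite /cou_mx invmx1 trmx1 -scalar_mx_block. Qed.

Lemma cou_act1 e : cou_act 1%:M e = e.
Proof. by rewrite /cou_act cou_mx1 mul1mx. Qed.

Lemma cou_end_act1 (J : 'M[R]_(n + n)) : cou_end_act 1%:M J = J.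
Proof. by rewrite /cou_end_act cou_mx1 invmx1 mulmx1 mul1mx. Qed.

Lemma cou_act_col A X (xi : 'cV[R]_n) :
  cou_act A (col_mx X xi) = col_mx (A *m X) ((invmx A)^T *m xi).
Proof. by rewrite /cou_act mul_block_col !mul0mx add0r addr0. Qed.

Lemma cou_mx_unit A : A \in unitmx -> cou_mx A \in unitmx.
Proof. by move=> uA; rewrite block_diag_mx_unit uA unitmx_tr unitmx_inv uA. Qed.

Section Unit.
Variable A : 'M[R]_n.
Hypothesis uA : A \in unitmx.

Lemma end_vec_act I X : end_act A I *m vec_act A X = vec_act A (I *m X).
Proof. by rewrite /end_act /vec_act -!mulmxA mulKmx. Qed.

Lemma end_actM I I' : end_act A I *m end_act A I' = end_act A (I *m I').
Proof. by rewrite /end_act -!mulmxA mulKmx. Qed.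

Lemma end_biv_act I P : end_act A I *m biv_act A P = biv_act A (I *m P).
Proof. by rewrite /end_act /biv_act -!mulmxA mulKmx. Qed.

Lemma end_actN1 : end_act A (- 1%:M) = - 1%:M.
Proof. by rewrite /end_act mulmxN mulmx1 mulNmx mulmxV. Qed.

Lemma form_vec_act F X :
  form_act A F *m vec_act A X = (invmx A)^T *m (F *m X).
Proof. by rewrite /form_act /vec_act -!mulmxA mulKmx. Qed.

Lemma cou_end_act_block I Q :
  cou_end_act A (gc_block I Q) = gc_block (end_act A I) (biv_act A Q).
Proof.
rewrite /cou_end_act invmx_block_diag; last exact: cou_mx_unit.
rewrite /cou_mx /gc_block !mulmx_block !(mulmx0, mul0mx, addr0, add0r).
rewrite trmx_inv invmxK; congr block_mx.
by rewrite /end_act !trmx_mul trmx_inv mulmxN mulNmx mulmxA.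
Qed.

Lemma cou_endM (J : 'M[R]_(n + n)) e :
  cou_end_act A J *m cou_act A e = cou_act A (J *m e).
Proof. by rewrite /cou_end_act /cou_act -!mulmxA mulKmx //; exact: cou_mx_unit. Qed.

End Unit.
End Actions.

Section GCBlock.
Context {R : realType} {V : normedModType R} {n : nat}.
Implicit Types f g : V -> 'M[R]_n.

Let left_linear : linear (fun A : 'M[R]_n => gc_block A 0).
Proof.
move=> a A B; rewrite /gc_block scale_block_mx add_block_mx !scaler0 !addr0.
by rewrite linearD linearZ /= opprD scalerN.
Qed.

Let right_linear : linear (fun A : 'M[R]_n => gc_block 0 A).
Proof.
move=> a A B; rewrite /gc_block scale_block_mx add_block_mx !scaler0 trmx0 oppr0.
by rewrite scaler0 !addr0.
Qed.

Let split f g : (fun x => gc_block (f x) (g x)) =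
  (fun x => gc_block (f x) 0 + gc_block 0 (g x)).
Proof.
apply/funext => x; rewrite /gc_block add_block_mx !addr0 add0r.
by rewrite trmx0 oppr0 addr0.
Qed.

Lemma derive_gc_block f g x v : differentiable f x -> differentiable g x ->
  'D_v (fun y => gc_block (f y) (g y)) x = gc_block ('D_v f x) ('D_v g x).
Proof.
move=> df dg; rewrite split derive_addf.
- rewrite (derive_lin left_linear _ df) (derive_lin right_linear _ dg).
  by rewrite /gc_block add_block_mx !addr0 add0r trmx0 oppr0 addr0.
- exact: (differentiable_lin left_linear).
- exact: (differentiable_lin right_linear).
Qed.

Lemma smooth_on_gc_block (A : set V) f g : open A -> smooth_on A f ->
  smooth_on A g -> smooth_on A (fun x => gc_block (f x) (g x)).
Proof.
move=> oA sf sg; rewrite split; apply: smooth_on_add => //.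
  exact: (smooth_on_lin left_linear).
exact: (smooth_on_lin right_linear).
Qed.

End GCBlock.

Section Partial.
Context {R : realType} {n : nat} {M : manifold R n}.
Implicit Types (p q : M) (W : set M).

Local Notation phi p := (chart_fun (chart_at p)).

Section Leibniz.
Variables (k l m : nat).
Variables (actA : 'M[R]_n -> 'M[R]_(k, l) -> 'M[R]_(k, l))
  (actB : 'M[R]_n -> 'M[R]_(l, m) -> 'M[R]_(l, m))
  (actC : 'M[R]_n -> 'M[R]_(k, m) -> 'M[R]_(k, m)).
Variables (W : set M) (oW : open W) (A : M -> 'M[R]_(k, l)) (B : M -> 'M[R]_(l, m))
  (C : M -> 'M[R]_(k, m)).
Hypothesis ABC : forall q (T : 'M[R]_n), W q -> T \in unitmx ->
  actA T (A q) *m actB T (B q) = actC T (C q).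

Let near_local_repM p : W p -> \forall x \near phi p p,
  local_rep actC C p x = local_rep actA A p x *m local_rep actB B p x.
Proof.
move=> Wp; apply: filterS (near_chart oW Wp) => x /chart_imageP[Wx px _].
by rewrite /local_rep ABC //; exact: transition_unit.
Qed.

(** Equivariance [ABC] makes the representative in the chart at p multiplicative near p, so the
    ordinary product rule applies. The factors [actA 1%:M] and [actB 1%:M] are the representatives
    at p itself, where the transition matrix is 1. *)
Lemma partialM p j : W p -> smooth_field actA W A -> smooth_field actB W B ->
  partial actC C p j =
    partial actA A p j *m actB 1%:M (B p) + actA 1%:M (A p) *m partial actB B p j.
Proof.
move=> Wp sA sB; rewrite /partial (near_eq_derive _ (near_local_repM Wp)).
rewrite derive_mulmx; last 2 first.
- exact: smooth_field_differentiable Wp sA.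
- exact: smooth_field_differentiable Wp sB.
by rewrite !local_rep_at.
Qed.

Lemma smooth_fieldM : smooth_field actA W A -> smooth_field actB W B ->
  smooth_field actC W C.
Proof.
move=> sA sB p; have oD := @open_chart_image _ _ _ _ p oW.
apply: smooth_on_ext (smooth_on_mulmx oD (sA p) (sB p)) => //.
move=> x /chart_imageP[Wx px _].
by rewrite /local_rep ABC //; exact: transition_unit.
Qed.

End Leibniz.

Section Linear.
Variables (k l k' l' : nat) (L : 'M[R]_(k, l) -> 'M[R]_(k', l')) (linL : linear L).
Variables (actA : 'M[R]_n -> 'M[R]_(k, l) -> 'M[R]_(k, l))
  (actB : 'M[R]_n -> 'M[R]_(k', l') -> 'M[R]_(k', l')).
Variables (W : set M) (oW : open W) (A : M -> 'M[R]_(k, l)) (B : M -> 'M[R]_(k', l')).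
Hypothesis AB : forall q (T : 'M[R]_n), W q -> T \in unitmx ->
  actB T (B q) = L (actA T (A q)).

Lemma partial_lin p j : W p -> smooth_field actA W A ->
  partial actB B p j = L (partial actA A p j).
Proof.
move=> Wp sA; rewrite /partial.
rewrite (@near_eq_derive _ _ _ _ (fun x => L (local_rep actA A p x))).
  by rewrite (derive_lin linL) //; exact: smooth_field_differentiable Wp sA.
apply: filterS (near_chart oW Wp) => x /chart_imageP[Wx px _].
by rewrite /local_rep AB //; exact: transition_unit.
Qed.

End Linear.

Lemma opp_trmx_linear : linear (fun A : 'M[R]_n => - A^T).
Proof. by move=> a u v; rewrite linearD linearZ /= opprD scalerN. Qed.

Lemma oppmx_linear k l : linear (-%R : 'M[R]_(k, l) -> _).
Proof. by move=> a u v; rewrite opprD scalerN. Qed.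

Section Add.
Variables (k l : nat) (act : 'M[R]_n -> 'M[R]_(k, l) -> 'M[R]_(k, l)).
Variables (W : set M) (oW : open W).
Hypothesis actD : forall (T : 'M[R]_n) X Y, act T (X + Y) = act T X + act T Y.

Lemma partialD (X Y : M -> 'M[R]_(k, l)) p j : W p ->
  smooth_field act W X -> smooth_field act W Y ->
  partial act (fun q => X q + Y q) p j = partial act X p j + partial act Y p j.
Proof.
move=> Wp sX sY; rewrite /partial /local_rep.
under [in LHS]eq_fun do rewrite actD.
rewrite derive_addf //.
- exact: smooth_field_differentiable Wp sX.
- exact: smooth_field_differentiable Wp sY.
Qed.

Lemma smooth_fieldD (X Y : M -> 'M[R]_(k, l)) :
  smooth_field act W X -> smooth_field act W Y ->
  smooth_field act W (fun q => X q + Y q).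
Proof.
move=> sX sY p; have oD := @open_chart_image _ _ _ _ p oW.
apply: smooth_on_ext (smooth_on_add oD (sX p) (sY p)) => // x _.
by rewrite /local_rep actD.
Qed.

End Add.

Lemma partial_frame p v j : partial (@vec_act R n) (frame_field p v) p j = 0.
Proof.
rewrite /partial (near_eq_derive _ (near_local_rep_frame p v)).
by rewrite derive_cst.
Qed.

End Partial.

(** * Directional derivatives as linear maps and extension from basis vectors *)

Section Along.
Context {K : comPzRingType} {n : nat}.
Implicit Types v w : 'cV[K]_n.

Section Dir.
Variables (k l : nat) (d : 'I_n -> 'M[K]_(k, l)).

Lemma alongD v w : along d (v + w) = along d v + along d w.
Proof. by rewrite /along -big_split; apply: eq_bigr => j _; rewrite mxE scalerDl. Qed.

Lemma alongZ a v : along d (a *: v) = a *: along d v.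
Proof. by rewrite /along scaler_sumr; apply: eq_bigr => j _; rewrite mxE scalerA. Qed.

Lemma along_mull m (A : 'M_(m, k)) v : along (fun j => A *m d j) v = A *m along d v.
Proof.
by rewrite /along mulmx_sumr; apply: eq_bigr => j _; rewrite scalemxAr.
Qed.

Lemma along_mulr m (A : 'M_(l, m)) v : along (fun j => d j *m A) v = along d v *m A.
Proof.
by rewrite /along mulmx_suml; apply: eq_bigr => j _; rewrite scalemxAl.
Qed.

Lemma along_tr v : (along d v)^T = along (fun j => (d j)^T) v.
Proof. by rewrite /along linear_sum; apply: eq_bigr => j _; rewrite linearZ. Qed.

Lemma along_add (d' : 'I_n -> 'M[K]_(k, l)) v :
  along (fun j => d j + d' j) v = along d v + along d' v.
Proof. by rewrite /along -big_split; apply: eq_bigr => j _; rewrite scalerDr. Qed.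

Lemma along_scale a v : along (fun j => a *: d j) v = a *: along d v.
Proof.
by rewrite /along scaler_sumr; apply: eq_bigr => j _; rewrite !scalerA mulrC.
Qed.

Lemma along_opp v : along (fun j => - d j) v = - along d v.
Proof. by rewrite /along -sumrN; apply: eq_bigr => j _; rewrite scalerN. Qed.

Lemma along_linear k' l' (L : 'M[K]_(k, l) -> 'M[K]_(k', l')) v : linear L ->
  along (fun j => L (d j)) v = L (along d v).
Proof.
move=> lL; rewrite /along.
have L0 : L 0 = 0 by have := lL (-1) 0 0; rewrite !scaleN1r oppr0 addr0 addNr.
by elim/big_rec2: _ => [|j x y _ ->]; rewrite ?L0 // lL.
Qed.

Lemma eq_along d' v : d =1 d' -> along d v = along d' v.
Proof. by move=> dd; apply: eq_bigr => j _; rewrite dd. Qed.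

End Dir.

Lemma jac_mxM k (d : 'I_n -> 'cV[K]_k) v : jac_mx d *m v = along d v.
Proof.
apply/colP => a; rewrite !mxE summxE; apply: eq_bigr => j _.
by rewrite !mxE mulrC.
Qed.

Lemma along_gc_block m (a b : 'I_n -> 'M[K]_m) v :
  gc_block (along a v) (along b v) = along (fun j => gc_block (a j) (b j)) v.
Proof.
rewrite /along; elim/big_rec3: _ => [|j x1 x2 x3 _ <-].
  by rewrite /gc_block trmx0 oppr0 block_mx_const.
rewrite /gc_block scale_block_mx add_block_mx scaler0 addr0.
by rewrite linearD linearZ /= opprD scalerN.
Qed.

Lemma linear_cV_eq0 (V : lmodType K) (f : 'cV[K]_n -> V) :
  (forall u v, f (u + v) = f u + f v) -> (forall a u, f (a *: u) = a *: f u) ->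
  (forall a, f (delta_mx a 0) = 0) -> forall u, f u = 0.
Proof.
move=> fD fZ f0 x; rewrite [x]matrix_sum_delta.
have fs : f 0 = 0 by rewrite -[0 in LHS](scale0r 0) fZ scale0r.
elim/big_rec: _ => // j y _ fy; rewrite fD fy big_ord1 fZ f0 scaler0.
exact: addr0.
Qed.

Lemma bilinear_cV_eq0 k (B : 'cV[K]_n -> 'cV[K]_n -> 'cV[K]_k) :
  (forall u v w, B (u + v) w = B u w + B v w) ->
  (forall a u w, B (a *: u) w = a *: B u w) ->
  (forall u v w, B w (u + v) = B w u + B w v) ->
  (forall a u w, B w (a *: u) = a *: B w u) ->
  (forall a b, B (delta_mx a 0) (delta_mx b 0) = 0) -> forall u v, B u v = 0.
Proof.
move=> BDl BZl BDr BZr B0 u v.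
by apply: (linear_cV_eq0 (f := B u)) => // b; apply: (linear_cV_eq0 (f := B^~ _)).
Qed.

End Along.

(** * Complexification, real and imaginary parts, conjugation *)

Section ComplexMatrix.
Context {R : realType}.
Local Notation im := ('i%C : R[i]).

Lemma im2 : im * im = -1.
Proof. by rewrite -expr2 sqr_i. Qed.

Lemma complex_nz2 : 2%:R != 0 :> R[i].
Proof. by rewrite Num.Theory.pnatr_eq0. Qed.

Section Shape.
Variables m n : nat.
Implicit Types (A : 'M[R]_(m, n)) (Z : 'M[R[i]]_(m, n)).

Lemma toC_ReIm Z : Z = toC (ReM Z) + im *: toC (ImM Z).
Proof. by apply/matrixP => i j; rewrite !mxE -complexE. Qed.

Lemma ReM_toC A B : ReM (toC A + im *: toC B) = A.
Proof. by apply/matrixP => i j; rewrite !mxE /= !(mul0r, mul1r, mulr0, subr0, addr0, oppr0). Qed.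

Lemma ImM_toC A B : ImM (toC A + im *: toC B) = B.
Proof. by apply/matrixP => i j; rewrite !mxE /= !(mul0r, mul1r, mulr0, add0r, addr0). Qed.

Lemma toC_inj A A' B B' :
  toC A + im *: toC B = toC A' + im *: toC B' -> A = A' /\ B = B'.
Proof. by move=> e; rewrite -(ReM_toC A B) -{2}(ImM_toC A B) e ReM_toC ImM_toC. Qed.

End Shape.

Lemma toCM m n p (A : 'M[R]_(m, n)) (B : 'M_(n, p)) : toC (A *m B) = toC A *m toC B.
Proof. exact: map_mxM. Qed.

Lemma toCD m n (A B : 'M[R]_(m, n)) : toC (A + B) = toC A + toC B.
Proof. exact: map_mxD. Qed.

Lemma toCN m n (A : 'M[R]_(m, n)) : toC (- A) = - toC A.
Proof. exact: map_mxN. Qed.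

Lemma toC_tr m n (A : 'M[R]_(m, n)) : toC A^T = (toC A)^T.
Proof. by rewrite /toC -map_trmx. Qed.

Lemma toC1 n : toC (1%:M : 'M[R]_n) = 1%:M.
Proof. exact: map_mx1. Qed.

Lemma toC_gc_block n (I Q : 'M[R]_n) : toC (gc_block I Q) = gc_block (toC I) (toC Q).
Proof. by rewrite /toC map_block_mx map_mx0 map_mxN -map_trmx. Qed.

Lemma mulmx_toC_ReIm m n p (A : 'M[R]_(m, n)) (Z : 'M[R[i]]_(n, p)) :
  toC A *m Z = toC (A *m ReM Z) + im *: toC (A *m ImM Z).
Proof. by rewrite {1}[Z]toC_ReIm mulmxDr -scalemxAr !toCM. Qed.

Lemma scale_im_ReIm m n (Z : 'M[R[i]]_(m, n)) :
  im *: Z = toC (- ImM Z) + im *: toC (ReM Z).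
Proof.
by rewrite {1}[Z]toC_ReIm scalerDr scalerA im2 scaleN1r addrC toCN.
Qed.

Lemma eigen_ReIm m n (A : 'M[R]_m) (Z : 'M[R[i]]_(m, n)) :
  toC A *m Z = im *: Z -> A *m ReM Z = - ImM Z /\ A *m ImM Z = ReM Z.
Proof. by rewrite [im *: Z]scale_im_ReIm mulmx_toC_ReIm => /toC_inj. Qed.

Definition conjM m n (Z : 'M[R[i]]_(m, n)) : 'M[R[i]]_(m, n) :=
  map_mx (@conjc R) Z.

Lemma conjM_toC m n (A : 'M[R]_(m, n)) : conjM (toC A) = toC A.
Proof. by apply/matrixP => a b; rewrite !mxE conjc_real. Qed.

Lemma conjM_mul m n p (A : 'M[R[i]]_(m, n)) (B : 'M_(n, p)) :
  conjM (A *m B) = conjM A *m conjM B.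
Proof. exact: map_mxM. Qed.

Lemma conjMZ m n a (A : 'M[R[i]]_(m, n)) : conjM (a *: A) = conjc a *: conjM A.
Proof. exact: map_mxZ. Qed.

Lemma conjc_im : conjc im = - im.
Proof. by apply/eqP; rewrite eq_complex /= oppr0 !eqxx. Qed.

Lemma dot_conj n (x y : 'cV[R[i]]_n) : dot (conjM x) (conjM y) = conjc (dot x y).
Proof. by rewrite /dot /conjM map_trmx -map_mxM mxE. Qed.

Lemma cpair_conj n (e f : 'cV[R[i]]_(n + n)) :
  cpair (conjM e) (conjM f) = conjc (cpair e f).
Proof.
rewrite /cpair /conjM -!map_usubmx -!map_dsubmx -/(conjM _) -/(conjM _).
by rewrite !dot_conj -rmorphD.
Qed.

Lemma conjM_gc_block n (I Q : 'M[R[i]]_n) :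
  conjM (gc_block I Q) = gc_block (conjM I) (conjM Q).
Proof. by rewrite /conjM map_block_mx map_mx0 map_mxN -map_trmx. Qed.

Lemma along_conj n k l (d : 'I_n -> 'M[R]_(k, l)) (v : 'cV[R[i]]_n) :
  conjM (along (fun j => toC (d j)) v) = along (fun j => toC (d j)) (conjM v).
Proof.
rewrite /along /conjM raddf_sum; apply: eq_bigr => j _ /=.
by rewrite -/(conjM _) conjMZ conjM_toC mxE.
Qed.

End ComplexMatrix.

(** * Integrability of the structure of a holomorphic Poisson manifold *)

Lemma along_toC (R : realType) n k l (d : 'I_n -> 'M[R]_(k, l)) (v : 'cV[R]_n) :
  along (fun j => toC (d j)) (toC v) = toC (along d v).
Proof.
rewrite /along /toC raddf_sum; apply: eq_bigr => j _ /=.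
by rewrite map_mxZ mxE.
Qed.

Lemma addr_alternating4 (V : zmodType) (a b c d e f g h : V) :
  (a + b) - (c + d) + (e + f) - (g + h) = (a - c + e - g) + (b - d + f - h).
Proof.
by rewrite !opprD (addrACA a) (addrACA (a - c)) (addrACA (a - c + e)).
Qed.

Lemma lie_bracket_partial (R : realType) n (M : manifold R n)
    (X Y : M -> 'cV[R]_n) p (dX dY : 'I_n -> 'cV[R]_n) :
  partial (@vec_act R n) X p =1 dX -> partial (@vec_act R n) Y p =1 dY ->
  lie_bracket X Y p = along dY (X p) - along dX (Y p).
Proof. by move=> /funext <- /funext <-; rewrite /lie_bracket !jac_mxM. Qed.

(** When the first derivatives of X and Y vanish at p, only derivatives of I survive in the four
    brackets, and the torsion becomes an algebraic expression in I and dI. *)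
Lemma nijenhuis_const (R : realType) n (M : manifold R n) (I : M -> 'M[R]_n)
    (dI : 'I_n -> 'M[R]_n) (X Y : M -> 'cV[R]_n) p :
  (forall j, partial (@vec_act R n) X p j = 0) ->
  (forall j, partial (@vec_act R n) Y p j = 0) ->
  (forall j, partial (@vec_act R n) (fun q => I q *m X q) p j = dI j *m X p) ->
  (forall j, partial (@vec_act R n) (fun q => I q *m Y q) p j = dI j *m Y p) ->
  nijenhuis I X Y p =
  along dI (I p *m X p) *m Y p - along dI (I p *m Y p) *m X p
  + I p *m (along dI (Y p) *m X p) - I p *m (along dI (X p) *m Y p).
Proof.
move=> dX dY dIX dIY.
have a0 v : along (fun _ : 'I_n => 0 : 'cV[R]_n) v = 0.
  by rewrite /along big1 // => j _; rewrite scaler0.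
have := lie_bracket_partial dIX dIY; have := lie_bracket_partial dIX dY.
have := lie_bracket_partial dX dIY; have := lie_bracket_partial dX dY.
rewrite /nijenhuis => -> -> -> ->.
by rewrite !along_mulr !a0 !subr0 sub0r mulmxN opprK.
Qed.

(** Trilinear extension from basis vectors. With s = 1 the same cyclic identity is the closedness of
    a 2-form, which is why s and d are arbitrary. *)
Lemma schouten_vectors (K : comPzRingType) n (s : 'M[K]_n) (d : 'I_n -> 'M[K]_n) :
  (forall a b c, \sum_l (s l a * d l b c + s l b * d l c a + s l c * d l a b) = 0) ->
  forall x y z, dot x (along d (s *m y) *m z) + dot z (along d (s *m x) *m y)
    + dot y (along d (s *m z) *m x) = 0.
Proof.
move=> H.
have E a b c : dot (delta_mx b 0) (along d (s *m delta_mx a 0) *m delta_mx c 0)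
    = \sum_l s l a * d l b c.
  rewrite dot_delta -colE mxE summxE; apply: eq_bigr => l _.
  by rewrite mxE -colE mxE.
move=> x y z; move: x; apply: (linear_cV_eq0 (V := K^o)).
- move=> u v; rewrite !(mulmxDr, alongD, mulmxDl, dotDl, dotDr); ring.
- move=> a u; rewrite -!scalemxAr alongZ -scalemxAl !(dotZl, dotZr) -!mulrDr.
  by [].
move=> b; move: y; apply: (linear_cV_eq0 (V := K^o)).
- move=> u v; rewrite !(mulmxDr, alongD, mulmxDl, dotDl, dotDr); ring.
- move=> a u; rewrite -!scalemxAr alongZ -scalemxAl !(dotZl, dotZr) -!mulrDr.
  by [].
move=> a; move: z; apply: (linear_cV_eq0 (V := K^o)).
- move=> u v; rewrite !(mulmxDr, alongD, mulmxDl, dotDl, dotDr); ring.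
- move=> c u; rewrite -!scalemxAr alongZ -scalemxAl !(dotZl, dotZr) -!mulrDr.
  by [].
by move=> c; rewrite !E -!big_split /=; exact: H.
Qed.

(** The equation is the shape taken by the dbar condition in [dbar_type01]: d + d because the test
    field has value 2 z at p, the factors 2 i because sigma is 2 i Q on forms of type (1,0), and the
    single factors i from the derivative of the test field. *)
Lemma solve_half_imag (K : fieldType) (i d e f : K) : i * i = -1 -> 2%:R != 0 :> K ->
  2%:R * i * (d + d) - i * (2%:R * i * e) - - (i * (2%:R * i * f)) = 0 ->
  d = i * 2%:R^-1 * (e - f).
Proof.
move=> ii nz2 H.
have nzi : i != 0.
  by apply/eqP => i0; move: ii => /eqP; rewrite i0 mul0r eq_sym oppr_eq0 oner_eq0.
apply: (mulfI (mulf_neq0 (mulf_neq0 nz2 nzi) nz2)).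
apply/eqP; rewrite -subr_eq0 -[X in _ == X]H; apply/eqP; field.
exact: nz2.
Qed.

Lemma conjc_sum3_eq0 (R : realType) (A B C a b c : R[i]) :
  A = conjc a -> B = conjc b -> C = conjc c -> A - B + C = 0 -> a - b + c = 0.
Proof.
by move=> -> -> ->; rewrite -rmorphB -rmorphD => /eqP; rewrite conjc_eq0 => /eqP.
Qed.

Lemma scaled_sum3_eq0 (K : idomainType) (k A B C a b c : K) : k != 0 ->
  A = k * a -> B = k * b -> C = k * c -> A + B + C = 0 -> a + c + b = 0.
Proof.
move=> k0 -> -> -> H; apply: (mulfI k0); rewrite mulr0 -[RHS]H; ring.
Qed.

Section Integrability.
Context {R : realType} {n : nat} {M : manifold R n}.
Variables (I : M -> 'M[R]_n) (sigma : M -> 'M[R[i]]_n).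
Hypothesis hp : holomorphic_poisson I sigma.

Local Notation im := ('i%C : R[i]).
Let P p := ReM (sigma p).
Let Q p := ImM (sigma p).

Let II p : I p *m I p = - 1%:M.
Proof. exact: ic_sqr (hp_complex hp) p. Qed.

Let IQP p : I p *m Q p = P p.
Proof. by have /eigen_ReIm[] := hp_type hp p. Qed.

Let skew_parts p : (P p)^T = - P p /\ (Q p)^T = - Q p.
Proof.
have := hp_skew hp p; rewrite [in LHS](toC_ReIm (sigma p)) linearD linearZ /= -!toC_tr.
by rewrite [in RHS](toC_ReIm (sigma p)) opprD -scalerN -!toCN => /toC_inj.
Qed.

Let QT p : (Q p)^T = - Q p.
Proof. by have [] := skew_parts p. Qed.

Let IQ p : I p *m Q p = Q p *m (I p)^T.
Proof.
have [PT _] := skew_parts p.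
by rewrite IQP -[LHS]opprK -PT -IQP trmx_mul QT mulNmx opprK.
Qed.

Lemma hp_im_skew p : (ImM (sigma p))^T = - ImM (sigma p).
Proof. exact: QT. Qed.

Let sI : smooth_field (@end_act R n) setT I.
Proof. exact: ic_smooth (hp_complex hp). Qed.

Let sQ : smooth_field (@biv_act R n) setT Q.
Proof. by have [_] := hp_smooth hp. Qed.

Let J q := gc_block (I q) (Q q).

Let gc_act T q : T \in unitmx ->
  cou_end_act T (J q) = gc_block (end_act T (I q)) (biv_act T (Q q)).
Proof. by move=> uT; rewrite cou_end_act_block. Qed.

Let sJ : smooth_field (@cou_end_act R n) setT J.
Proof.
move=> q; have oD := @open_chart_image _ _ M _ q openT.
apply: smooth_on_ext (smooth_on_gc_block oD (sI q) (sQ q)) => //.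
by move=> x /chart_imageP[_ qx _]; rewrite /local_rep gc_act //; exact: transition_unit.
Qed.

Section AtPoint.
Variable p : M.
Let dI := partial (@end_act R n) I p.
Let dQ := partial (@biv_act R n) Q p.

Let dII j : dI j *m I p = - (I p *m dI j).
Proof.
have H : partial (@end_act R n) (fun=> - 1%:M) p j =
    dI j *m end_act 1%:M (I p) + end_act 1%:M (I p) *m dI j.
  apply: (partialM openT _ _ Logic.I sI sI) => q T _ uT.
  by rewrite end_actM // II.
move: H; rewrite !end_act1 => H.
apply/eqP; rewrite -addr_eq0; apply/eqP; rewrite -H.
(* Conjugation fixes -1, so this field has a constant representative and the Leibniz expansion of I
   I vanishes. *)
rewrite /partial (@near_eq_derive _ _ _ _ (cst (- 1%:M))) ?derive_cst //.
apply: filterS (near_chart_at (dom_chart_at p)) => x [px _].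
by rewrite /local_rep end_actN1 //; exact: transition_unit.
Qed.

Let dQT j : (dQ j)^T = - dQ j.
Proof.
rewrite -[LHS]opprK; congr (- _); apply/esym.
(* Q is a fixed point of the linear map A -> - A^T, which commutes with changes of chart; hence so
   are its derivatives. *)
apply: (partial_lin (@opp_trmx_linear R n) openT) => // q T _ _.
by rewrite /biv_act !trmx_mul trmxK QT mulNmx mulmxN opprK mulmxA.
Qed.

Let dP j : partial (@biv_act R n) P p j = dI j *m Q p + I p *m dQ j.
Proof.
rewrite (@partialM _ _ M _ _ _ (@end_act R n) (@biv_act R n) _ _ openT I Q) //.
  by rewrite end_act1 biv_act1.
by move=> q T _ uT; rewrite end_biv_act // IQP.
Qed.

Let dom := chart_dom (chart_at p).
Let odom : open dom.
Proof. exact: open_chart_dom. Qed.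
Let domp : dom p.
Proof. exact: dom_chart_at. Qed.
Let sIdom : smooth_field (@end_act R n) dom I.
Proof. exact: smooth_field_subset sI. Qed.

Let sIframe v : smooth_field (@vec_act R n) dom (fun q => I q *m frame_field p v q).
Proof.
apply: (smooth_fieldM odom _ sIdom (@frame_field_smooth _ _ _ p v)).
by move=> q T _ uT; rewrite end_vec_act.
Qed.

Let dIframe v j :
  partial (@vec_act R n) (fun q => I q *m frame_field p v q) p j = dI j *m v.
Proof.
rewrite (@partialM _ _ M _ _ _ (@end_act R n) (@vec_act R n) _ _ odom
  I (frame_field p v)) //; first last.
- exact: frame_field_smooth.
- by move=> q T _ uT; rewrite end_vec_act.
by rewrite partial_frame mulmx0 addr0 vec_act1 frame_field_at.
Qed.

Let nijenhuis_frame v w :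
  along dI (I p *m v) *m w - along dI (I p *m w) *m v
  + I p *m (along dI w *m v) - I p *m (along dI v *m w) = 0.
Proof.
have := ic_integrable (hp_complex hp) odom (@frame_field_smooth _ _ _ p v)
  (@frame_field_smooth _ _ _ p w) domp.
rewrite (nijenhuis_const (dI := dI)) ?frame_field_at //.
- exact: partial_frame.
- exact: partial_frame.
Qed.

Let Ic := toC (I p).
Let Qc := toC (Q p).
Let dIc := along (fun j => toC (dI j)).
Let dQc := along (fun j => toC (dQ j)).

(** Both sides are complex bilinear and the basis vectors are real, so [nijenhuis_frame] extends to
    complex vectors, in particular to those of type (0,1). *)
Let nijenhuisC u v :
  dIc (Ic *m u) *m v - dIc (Ic *m v) *m u
  + Ic *m (dIc v *m u) - Ic *m (dIc u *m v) = 0.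
Proof.
move: u v; apply: bilinear_cV_eq0.
- move=> u v w; rewrite /dIc !mulmxDr !alongD !mulmxDl !mulmxDr.
  by rewrite addr_alternating4.
- move=> a u w; rewrite /dIc -!scalemxAr !alongZ -!scalemxAl.
  by rewrite -!scalemxAr !scalerDr !scalerN.
- move=> u v w; rewrite /dIc !mulmxDr !alongD !mulmxDl !mulmxDr.
  by rewrite addr_alternating4.
- move=> a u w; rewrite /dIc -!scalemxAr !alongZ -!scalemxAl.
  by rewrite -!scalemxAr !scalerDr !scalerN.
move=> a b.
have toC_delta c : delta_mx c 0 = toC (delta_mx c 0 : 'cV[R]_n).
  by rewrite /toC map_delta_mx.
rewrite /dIc /Ic !toC_delta -!toCM !along_toC -!toCM -!toCN -!toCD.
by rewrite nijenhuis_frame /toC map_mx0.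
Qed.

Let IcQc : Ic *m Qc = Qc *m Ic^T.
Proof. by rewrite /Ic /Qc -toC_tr -!toCM IQ. Qed.

Let QcT : Qc^T = - Qc.
Proof. by rewrite /Qc -toC_tr QT toCN. Qed.

Let dIIc v : dIc v *m Ic = - (Ic *m dIc v).
Proof.
rewrite /dIc -along_mulr -along_mull -along_opp; apply: eq_along => j.
by rewrite /Ic -!toCM dII toCN.
Qed.

Let dQTc v : (dQc v)^T = - dQc v.
Proof.
rewrite /dQc along_tr -along_opp; apply: eq_along => j.
by rewrite -toC_tr dQT toCN.
Qed.

Let sigmaE : sigma p = Ic *m Qc + im *: Qc.
Proof. by rewrite [LHS]toC_ReIm /Ic /Qc -toCM IQP. Qed.

Let dsigma := partialC (@biv_act R n) sigma p.

Let dIcD u v : dIc (u + v) = dIc u + dIc v.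
Proof. exact: alongD. Qed.

Let dIcZ a v : dIc (a *: v) = a *: dIc v.
Proof. exact: alongZ. Qed.

Let dQcD u v : dQc (u + v) = dQc u + dQc v.
Proof. exact: alongD. Qed.

Let dQcZ a v : dQc (a *: v) = a *: dQc v.
Proof. exact: alongZ. Qed.

Let dsigmaZ a v : along dsigma (a *: v) = a *: along dsigma v.
Proof. exact: alongZ. Qed.

Let along_dsigma v :
  along dsigma v = dIc v *m Qc + Ic *m dQc v + im *: dQc v.
Proof.
rewrite /dIc /dQc -along_mulr -along_mull -along_scale -!along_add.
by apply: eq_along => j; rewrite /dsigma /partialC dP toCD !toCM.
Qed.

Let sigma_type10 (x : 'cV[R[i]]_n) : Ic^T *m x = im *: x ->
  sigma p *m x = (2%:R * im) *: (Qc *m x).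
Proof.
move=> tx; rewrite sigmaE mulmxDl IcQc -mulmxA tx -scalemxAr -scalemxAl -scalerDl.
by rewrite mulr_natl mulr2n.
Qed.

(** In the derivative of sigma = I Q + i Q the term dI Q dies by [dI_type10], and transposing I onto
    x makes I dQ contribute a second i dQ. *)
Let dsigma_type10 v (x y : 'cV[R[i]]_n) : Ic^T *m x = im *: x -> Ic^T *m y = im *: y ->
  dot x (along dsigma v *m y) = 2%:R * im * dot x (dQc v *m y).
Proof.
move=> tx ty; rewrite along_dsigma !mulmxDl !dotDr -!mulmxA.
rewrite (dI_type10 im2 complex_nz2 IcQc dIIc) // -[dot x (Ic *m _)]dot_trmxl tx.
by rewrite -scalemxAl dotZl dotZr; ring.
Qed.

(** On forms of type (1,0), sigma and its derivative are 2 i times Q and dQ, so [sigma, sigma] = 0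
    is the claim up to the nonzero factor (2 i)^2. *)
Let poisson_type10 (x y z : 'cV[R[i]]_n) : Ic^T *m x = im *: x -> Ic^T *m y = im *: y ->
  Ic^T *m z = im *: z ->
  dot x (dQc (Qc *m y) *m z) + dot y (dQc (Qc *m z) *m x)
  + dot z (dQc (Qc *m x) *m y) = 0.
Proof.
move=> tx ty tz.
have E (u v w : 'cV[R[i]]_n) : Ic^T *m u = im *: u -> Ic^T *m v = im *: v ->
    Ic^T *m w = im *: w -> dot u (along dsigma (sigma p *m v) *m w) =
      2%:R * im * (2%:R * im) * dot u (dQc (Qc *m v) *m w).
  move=> tu tv tw; rewrite (sigma_type10 tv) dsigmaZ -scalemxAl dotZr.
  by rewrite -[RHS]mulrA; congr (_ * _); exact: dsigma_type10 tu tw.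
have nz : (2%:R * im) * (2%:R * im) != 0 :> R[i].
  by rewrite mulrACA im2 mulrN1 oppr_eq0 mulf_neq0 // complex_nz2.
apply: (scaled_sum3_eq0 nz (E x y z tx ty tz) (E z x y tz tx ty) (E y z x ty tz tx)).
exact: (schouten_vectors (fun a b c => hp_poisson hp p a b c)).
Qed.

(** Paired with x of type (1,0), the four terms of the torsion add up in pairs to - 2 i times the
    difference of the two sides. *)
Let nijenhuis_type01 (Z W : 'cV[R[i]]_n) : Ic *m Z = - im *: Z -> Ic *m W = - im *: W ->
  forall x : 'cV[R[i]]_n, Ic^T *m x = im *: x -> dot x (dIc Z *m W) = dot x (dIc W *m Z).
Proof.
move=> tZ tW x tx; have := nijenhuisC Z W.
rewrite tZ tW !dIcZ -!scalemxAl.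
move=> /(congr1 (dot x)); rewrite dot0r !(dotDr, dotNr) !dotZr.
rewrite -![dot x (Ic *m _)]dot_trmxl tx !dotZl => H.
apply/eqP; rewrite -subr_eq0; apply/eqP.
apply: (mulfI (mulf_neq0 complex_nz2 (_ : im != 0))).
  by rewrite eq_complex /= oner_eq0 andbF.
by rewrite mulr0 -[RHS]oppr0 -[in RHS]H; ring.
Qed.

(* For constant a and b, the field (1 + i I) (a + i b), of type (0,1), has real
   part frame01 a (- b) and imaginary part frame01 b a. *)
Let frame01 (a b : 'cV[R]_n) q := frame_field p a q + I q *m frame_field p b q.

Let frame01_smooth a b : smooth_field (@vec_act R n) dom (frame01 a b).
Proof.
apply: smooth_fieldD => //; first by move=> T X Y; rewrite /vec_act mulmxDr.
exact: frame_field_smooth.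
Qed.

Let partial_frame01 a b j : partial (@vec_act R n) (frame01 a b) p j = dI j *m b.
Proof.
rewrite /frame01 (@partialD _ _ M _ _ _ dom); first last.
- exact: sIframe.
- exact: frame_field_smooth.
- exact: domp.
- by move=> T X Y; rewrite /vec_act mulmxDr.
by rewrite partial_frame add0r dIframe.
Qed.

Let frame01_at a b : frame01 a b p = a + I p *m b.
Proof. by rewrite /frame01 !frame_field_at. Qed.

Let proj10T (x : 'cV[R[i]]_n) : Ic^T *m x = im *: x -> (proj10 (I p))^T *m x = x.
Proof.
move=> tx; rewrite /proj10 -/Ic.
have -> : (2^-1 *: (1%:M - im *: Ic))^T = 2^-1 *: (1%:M - im *: Ic^T).
  by rewrite linearZ /= linearB /= linearZ /= trmx1.
rewrite -scalemxAl mulmxBl mul1mx -scalemxAl tx (scalerA im im x) im2 scaleN1r opprK.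
by rewrite -{1 2}[x]scale1r -scalerDl (scalerA _ _ x) mulVf ?scale1r // complex_nz2.
Qed.

(** The dbar condition is applied to the extension (1 + i I) z of z, with z constant in the chart at
    p. It is of type (0,1) throughout the chart domain, has value 2 z at p, and its derivative along
    v is i dI(v) z, the source of the dI terms on the right. *)
Let dbar_type01 (z x y : 'cV[R[i]]_n) : Ic *m z = - im *: z ->
  Ic^T *m x = im *: x -> Ic^T *m y = im *: y ->
  dot x (dQc z *m y) =
  im * 2%:R^-1 * (dot x (dIc (Qc *m y) *m z) - dot y (dIc (Qc *m x) *m z)).
Proof.
move=> tz tx ty.
pose a := ReM z; pose b := ImM z.
have [Ia Ib] : I p *m a = b /\ I p *m b = - a.
  move: tz; rewrite /Ic mulmx_toC_ReIm scaleNr [im *: z]scale_im_ReIm.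
  by rewrite opprD -scalerN -!toCN opprK => /toC_inj.
pose A := frame01 a (- b); pose B := frame01 b a.
pose Z q := toC (A q) + im *: toC (B q).
have ReZ : (fun q => ReM (Z q)) = A by apply/funext => q; rewrite ReM_toC.
have ImZ : (fun q => ImM (Z q)) = B by apply/funext => q; rewrite ImM_toC.
have sZ : smooth_fieldC (@vec_act R n) dom Z.
  by rewrite /smooth_fieldC ReZ ImZ; split; exact: frame01_smooth.
have tZ q : dom q -> toC (I q) *m Z q = - im *: Z q.
  move=> _.
  have IA : I q *m A q = B q.
    rewrite /A /B /frame01 /frame_field !mulmxN mulmxDr mulmxN mulmxA II mulNmx.
    by rewrite mul1mx opprK addrC.
  have IB : I q *m B q = - A q by rewrite -IA mulmxA II mulNmx mul1mx.
  rewrite /Z mulmxDr -scalemxAr -!toCM IA IB scalerDr (scalerA _ im) mulNr im2 opprK.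
  by rewrite scale1r toCN scalerN scaleNr addrC.
have Zp : Z p = z + z.
  rewrite /Z /A /B !frame01_at Ia mulmxN Ib opprK !toCD scalerDr addrACA.
  by rewrite -toC_ReIm.
pose DZ := jac_mx (partialC (@vec_act R n) Z p).
have DZE v : DZ *m v = im *: (dIc v *m z).
  rewrite /DZ jac_mxM /dIc -along_mulr -along_scale; apply: eq_along => j.
  rewrite /partialC ReZ ImZ !partial_frame01 mulmx_toC_ReIm scalerDr scalerA im2.
  by rewrite scaleN1r addrC mulmxN toCN.
have := hp_holomorphic hp odom sZ tZ domp.
(* Evaluation on x and y of type (1,0) absorbs the two projections, whose transposes fix such
   forms. *)
move=> /(congr1 (fun L => dot x (L *m y))).
rewrite mul0mx dot0r -!mulmxA -[dot x (proj10 _ *m _)]dot_trmxl (proj10T tx) (proj10T ty).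
rewrite /lie_bivector -/dsigma -/DZ !mulmxBl !(dotDr, dotNr) Zp.
rewrite (dsigma_type10 _ tx ty) -!mulmxA (sigma_type10 ty) DZE.
rewrite -[dot x (sigma p *m _)]dot_trmxl (hp_skew hp) mulNmx dotNl.
rewrite [dot (sigma p *m x) _]dotC dot_trmxl (sigma_type10 tx) DZE.
rewrite dQcD !dIcZ -!scalemxAl mulmxDl !(dotDr, dotZr) => H.
exact: solve_half_imag im2 complex_nz2 H.
Qed.

Let tensor0 (e1 e2 e3 : 'cV[R[i]]_(n + n)) :
  gc_block Ic Qc *m e1 = im *: e1 -> gc_block Ic Qc *m e2 = im *: e2 ->
  gc_block Ic Qc *m e3 = im *: e3 ->
  cpair (gc_block (dIc (usubmx e1)) (dQc (usubmx e1)) *m e2) e3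
  - cpair (gc_block (dIc (usubmx e2)) (dQc (usubmx e2)) *m e1) e3
  + cpair (gc_block (dIc (usubmx e3)) (dQc (usubmx e3)) *m e1) e2 = 0.
Proof.
move=> J1 J2 J3.
(* J is real: conjugation exchanges its eigenbundles *)
have conjJ (e : 'cV_(n + n)) : gc_block Ic Qc *m e = im *: e ->
    gc_block Ic Qc *m conjM e = - im *: conjM e.
  move=> /(congr1 (@conjM _ _ _)); rewrite conjM_mul conjMZ conjc_im.
  by rewrite conjM_gc_block !conjM_toC.
have dIconj v : dIc (conjM v) = conjM (dIc v) := esym (along_conj dI v).
have dQconj v : dQc (conjM v) = conjM (dQc v) := esym (along_conj dQ v).
have uconj (e : 'cV[R[i]]_(n + n)) : usubmx (conjM e) = conjM (usubmx e).
  by rewrite /conjM map_usubmx.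
have conjT (e f g : 'cV_(n + n)) :
    cpair (gc_block (dIc (usubmx (conjM e))) (dQc (usubmx (conjM e)))
      *m conjM f) (conjM g) =
    conjc (cpair (gc_block (dIc (usubmx e)) (dQc (usubmx e)) *m f) g).
  by rewrite uconj dIconj dQconj -conjM_gc_block -conjM_mul cpair_conj.
have := gc_tensor0 im2 complex_nz2 dIcD dIcZ dQcD dQcZ IcQc dIIc dQTc
  nijenhuis_type01 dbar_type01 poisson_type10 (conjJ _ J1) (conjJ _ J2) (conjJ _ J3).
exact: (conjc_sum3_eq0 (conjT e1 e2 e3) (conjT e2 e1 e3) (conjT e3 e1 e2)).
Qed.

Let dJ j : partial (@cou_end_act R n) J p j = gc_block (dI j) (dQ j).
Proof.
rewrite /partial (@near_eq_derive _ _ _ _ (fun x => gc_block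
  (local_rep (@end_act R n) I p x) (local_rep (@biv_act R n) Q p x))).
  rewrite derive_gc_block //.
  - exact: smooth_field_differentiable Logic.I sI.
  - exact: smooth_field_differentiable Logic.I sQ.
apply: filterS (near_chart_at (dom_chart_at p)) => x [px _].
by rewrite /local_rep gc_act //; exact: transition_unit.
Qed.

(** This is the derivative of J e = i e. As [partialC] is defined through real and imaginary parts,
    the equation is split into J Re e = - Im e and J Im e = Re e, and each half is differentiated
    over the reals. *)
Let section_derivative (W : set M) (e : M -> 'cV[R[i]]_(n + n)) v :
  open W -> W p -> smooth_fieldC (@cou_act R n) W e ->
  (forall q, W q -> toC (J q) *m e q = im *: e q) ->
  gc_block (dIc v) (dQc v) *m e p
  + gc_block Ic Qc *m (jac_mx (partialC (@cou_act R n) e p) *m v)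
  = im *: (jac_mx (partialC (@cou_act R n) e p) *m v).
Proof.
move=> oW Wp [sr si] Je.
have sJW : smooth_field (@cou_end_act R n) W J by exact: smooth_field_subset sJ.
have Jr q : W q -> J q *m ReM (e q) = - ImM (e q) by move=> /Je /eigen_ReIm[].
have Ji q : W q -> J q *m ImM (e q) = ReM (e q) by move=> /Je /eigen_ReIm[].
pose er q := ReM (e q); pose ei q := ImM (e q).
pose Dr := partial (@cou_act R n) er p; pose Di := partial (@cou_act R n) ei p.
have Er j : - Di j = gc_block (dI j) (dQ j) *m er p + J p *m Dr j.
  rewrite -dJ -(partial_lin (@oppmx_linear R (n + n) 1) oW
    (actB := @cou_act R n) (B := fun q => - ei q)) //; last first.
    by move=> q T _ _; rewrite /cou_act mulmxN.
  rewrite (partialM oW (actA := @cou_end_act R n) (actB := @cou_act R n)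
    (A := J) (B := er)) //.
    by rewrite cou_act1 cou_end_act1.
  by move=> q T Wq uT; rewrite cou_endM // Jr.
have Ei j : Dr j = gc_block (dI j) (dQ j) *m ei p + J p *m Di j.
  rewrite -dJ /Dr (partialM oW (actA := @cou_end_act R n) (actB := @cou_act R n)
    (A := J) (B := ei)) //.
    by rewrite cou_act1 cou_end_act1.
  by move=> q T Wq uT; rewrite cou_endM // Ji.
rewrite jac_mxM /dIc /dQc along_gc_block -along_mulr -along_mull -along_scale.
rewrite -along_add; apply: eq_along => j.
rewrite /Ic /Qc -!toC_gc_block !mulmx_toC_ReIm [RHS]scale_im_ReIm.
rewrite addrACA -scalerDr -!toCD /partialC ReM_toC ImM_toC.
by rewrite -[partial _ _ p j]/(Dr j) -[X in toC (- X)]/(Di j) Er {3}Ei.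
Qed.

Lemma poisson_gc_involutive (W : set M) (e e' : M -> 'cV[R[i]]_(n + n)) :
  open W -> smooth_fieldC (@cou_act R n) W e -> smooth_fieldC (@cou_act R n) W e' ->
  (forall q, W q ->
     toC (poisson_gc I (fun r => ImM (sigma r)) q) *m e q = im *: e q) ->
  (forall q, W q ->
     toC (poisson_gc I (fun r => ImM (sigma r)) q) *m e' q = im *: e' q) ->
  W p -> toC (poisson_gc I (fun r => ImM (sigma r)) p) *m std_bracketC e e' p
         = im *: std_bracketC e e' p.
Proof.
move=> oW se se' Je Je' Wp.
have IIc : Ic *m Ic = - 1%:M by rewrite -toCM II toCN toC1.
have Jc : toC (poisson_gc I (fun r => ImM (sigma r)) p) = gc_block Ic Qc.
  exact: toC_gc_block.
rewrite Jc; apply: (bracket_eigen im2 complex_nz2 IIc QcT IcQc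
  (dI := dIc) (dQ := dQc)).
- by rewrite -Jc; exact: Je.
- by rewrite -Jc; exact: Je'.
- by move=> v; exact: section_derivative Je.
- by move=> v; exact: section_derivative Je'.
- by move=> e3 J3; apply: tensor0 J3; rewrite -Jc; [exact: Je|exact: Je'].
Qed.

End AtPoint.

Lemma poisson_generalized_complex :
  generalized_complex (poisson_gc I (fun p => ImM (sigma p))).
Proof.
split.
- exact: sJ.
- move=> p; exact: gc_block_sqr (II p) (IQ p).
- move=> p e e'.
  rewrite !std_pairingE; exact: (cpair_gc_block_orthogonal _ _ (II p) (QT p) (IQ p)).
- move=> W e e' oW se se' Je Je' p Wp.
  exact: poisson_gc_involutive oW se se' Je Je' Wp.
Qed.

End Integrability.

(** * The diagonal and the graph of a closed 2-form *)

Section PairPart.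
Context {R : realType} {m n : nat}.

Lemma fst_pair_part (e0 : 'cV[R]_(m + m)) (e1 : 'cV[R]_(n + n)) : fst_part (pair_part e0 e1) = e0.
Proof. by rewrite /fst_part /pair_part !(col_mxKu, col_mxKd) vsubmxK. Qed.

Lemma snd_pair_part (e0 : 'cV[R]_(m + m)) (e1 : 'cV[R]_(n + n)) : snd_part (pair_part e0 e1) = e1.
Proof. by rewrite /snd_part /pair_part !(col_mxKu, col_mxKd) vsubmxK. Qed.

Lemma pair_partK (e : 'cV[R]_((m + n) + (m + n))) :
  pair_part (fst_part e) (snd_part e) = e.
Proof. by rewrite /fst_part /snd_part /pair_part !(col_mxKu, col_mxKd) !vsubmxK. Qed.

Lemma pair_part_col (X : 'cV[R]_m) xi (Y : 'cV[R]_n) eta :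
  pair_part (col_mx X xi) (col_mx Y eta) = col_mx (col_mx X Y) (col_mx xi eta).
Proof. by rewrite /pair_part !(col_mxKu, col_mxKd). Qed.

Lemma flip_col (X : 'cV[R]_m) (Y : 'cV[R]_n) xi eta :
  flip (col_mx (col_mx X Y) (col_mx xi eta)) =
  col_mx (col_mx X Y) (col_mx (- xi) eta).
Proof. by rewrite /flip !(col_mxKu, col_mxKd). Qed.

Lemma flip_linear : linear (@flip R m n).
Proof.
move=> a u v; rewrite /flip !scale_col_mx !add_col_mx.
by rewrite !linearP.
Qed.

Lemma cou_act_pair_part (A : 'M[R]_m) (B : 'M[R]_n)
    (e0 : 'cV_(m + m)) (e1 : 'cV_(n + n)) :
  A \in unitmx -> B \in unitmx ->
  cou_act (block_mx A 0 0 B) (pair_part e0 e1) =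
  pair_part (cou_act A e0) (cou_act B e1).
Proof.
move=> uA uB; rewrite -[e0]vsubmxK -[e1]vsubmxK pair_part_col !cou_act_col.
rewrite pair_part_col invmx_block_diag ?block_diag_mx_unit ?uA // tr_block_mx.
by rewrite !mul_block_col !trmx0 !mul0mx !addr0 !add0r.
Qed.

Lemma cou_act_flip (A : 'M[R]_m) (B : 'M[R]_n) (e : 'cV_((m + n) + (m + n))) :
  A \in unitmx -> B \in unitmx ->
  cou_act (block_mx A 0 0 B) (flip e) = flip (cou_act (block_mx A 0 0 B) e).
Proof.
move=> uA uB; rewrite -[e]vsubmxK -[usubmx e]vsubmxK -[dsubmx e]vsubmxK.
rewrite flip_col -!pair_part_col !cou_act_pair_part // !cou_act_col !pair_part_col.
by rewrite flip_col mulmxN.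
Qed.

End PairPart.

(** * Changes of chart on a product *)

Section ProdTransition.
Context {R : realType} {m n : nat} {M : manifold R m} {N : manifold R n}.

Lemma usubmx_linear (k l : nat) : linear (@usubmx R k l 1).
Proof. exact: linearP. Qed.

Lemma dsubmx_linear (k l : nat) : linear (@dsubmx R k l 1).
Proof. exact: linearP. Qed.

Lemma prod_transition (p q : prod_manifold M N) :
  chart_dom (chart_at p.1) q.1 -> chart_dom (chart_at p.2) q.2 ->
  transition p q = block_mx (transition p.1 q.1) 0 0 (transition p.2 q.2).
Proof.
move=> pq1 pq2; apply: mulmx_cV_inj => v.
set g0 := chart_fun (chart_at p.1) \o chart_inv (chart_at q.1).
set g1 := chart_fun (chart_at p.2) \o chart_inv (chart_at q.2).
have d0 := coord_change_differentiable pq1 (dom_chart_at q.1).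
have d1 := coord_change_differentiable pq2 (dom_chart_at q.2).
set x := chart_fun (chart_at q) q.
have ux : usubmx x = chart_fun (chart_at q.1) q.1 by rewrite col_mxKu.
have dx : dsubmx x = chart_fun (chart_at q.2) q.2 by rewrite col_mxKd.
have du : differentiable (@usubmx R m n 1) x.
  exact: (differentiable_lin (f := id) (@usubmx_linear m n)).
have dd : differentiable (@dsubmx R m n 1) x.
  exact: (differentiable_lin (f := id) (@dsubmx_linear m n)).
have d0' : differentiable (fun y => g0 (usubmx y)) x.
  by apply: (differentiable_comp du); rewrite ux.
have d1' : differentiable (fun y => g1 (dsubmx y)) x.
  by apply: (differentiable_comp dd); rewrite dx.
rewrite [LHS](jacM (f := fun y => col_mx (g0 (usubmx y)) (g1 (dsubmx y)))); last first.
  exact: differentiable_col_mx.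
rewrite (derive_col_mx _ d0' d1') -[v in RHS]vsubmxK mul_block_col !mul0mx addr0 add0r.
have Du : 'D_v (@usubmx R m n 1) x = usubmx v.
  by rewrite (derive_lin (f := id) (@usubmx_linear m n)) // derive_id.
have Dd : 'D_v (@dsubmx R m n 1) x = dsubmx v.
  by rewrite (derive_lin (f := id) (@dsubmx_linear m n)) // derive_id.
congr col_mx.
  rewrite (derive_chain (f := g0) v du) ux // Du.
  exact: (esym (jacM _ d0)).
rewrite (derive_chain (f := g1) v dd) dx // Dd.
exact: (esym (jacM _ d1)).
Qed.

End ProdTransition.

Section Diagonal.
Context {R : realType} {n : nat} {M : manifold R n}.
Implicit Types (p q : M).

Local Notation phi p := (chart_fun (chart_at p)).
Local Notation phiV p := (chart_inv (chart_at p)).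
Local Notation dom p := (chart_dom (chart_at p)).
Local Notation diag := (diagonal_map (M := M)).
Local Notation EE := (opp_prod_courant M M).

Definition delta_col (K : nzRingType) k : 'M[K]_(k + k, k) := col_mx 1%:M 1%:M.

Lemma delta_colM k l (x : 'M[R]_(k, l)) : delta_col R k *m x = col_mx x x.
Proof. by rewrite mul_col_mx mul1mx. Qed.

Lemma diag_transition p q : dom p q ->
  transition (diag p) (diag q) = block_mx (transition p q) 0 0 (transition p q).
Proof. by move=> pq; rewrite prod_transition. Qed.

Lemma diag_smooth_map : smooth_map diag.
Proof.
split=> [p|p].
  have c : {for p, continuous (fun q : M => q)} by exact: cvg_id.
  exact: (cvg_pair c c).
have oD := @open_chart_image _ _ M _ p openT.
have l : linear (fun x : 'cV[R]_n => col_mx x x).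
  by move=> a u v; rewrite scale_col_mx add_col_mx.
apply: (@smooth_on_subset _ _ _ _ (phi p @` (setT `&` dom p))).
  by move=> _ [q [dq _] <-]; exists q.
apply: smooth_on_ext (smooth_on_lin l oD (smooth_on_id _)) => //.
by move=> x /chart_imageP[_ _ px]; rewrite /= px.
Qed.

Lemma id_smooth_map : smooth_map (fun p : M => p).
Proof.
split=> [p|p]; first exact: cvg_id.
have oD := @open_chart_image _ _ M _ p openT.
apply: (@smooth_on_subset _ _ _ _ (phi p @` (setT `&` dom p))).
  by move=> _ [q [dq _] <-]; exists q.
apply: smooth_on_ext (smooth_on_id _) => //.
by move=> x /chart_imageP[_ _ px]; rewrite /= px.
Qed.

Lemma id_diffeomorphism : diffeomorphism (fun p : M => p).
Proof. by split; [exact: id_smooth_map|exists id; split => //; exact: id_smooth_map]. Qed.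

Lemma diag_tangent_map p : tangent_map diag p = delta_col R n.
Proof.
have l : linear (fun x : 'cV[R]_n => delta_col R n *m x) by exact: linearP.
rewrite /tangent_map (@near_eq_jac _ _ _ _ (fun x => delta_col R n *m x)).
  by apply: mulmx_cV_inj => v; rewrite jac_lin.
apply: filterS (near_chart_at (dom_chart_at p)) => x [_ px].
by rewrite delta_colM /= px.
Qed.

Lemma diag_embedding : embedding diag.
Proof.
split; first exact: diag_smooth_map.
- by move=> p q [].
- move=> U oU; exists (U `*` U); first exact: open_setX.
  by apply/seteqP; split => p //= [].
- move=> p; rewrite diag_tangent_map; apply/eqP; rewrite eqn_leq rank_leq_col /=.
  (* The first projection is a left inverse of the differential of the diagonal. *)
  have := mxrankM_maxr (row_mx 1%:M 0 : 'M[R]_(n, n + n)) (delta_col R n).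
  by rewrite /delta_col mul_row_col mul0mx addr0 mul1mx mxrank1.
Qed.

Section Trivialization.
Variable F : M -> 'M[R]_n.

(** The value at v is an element of E_S, hence a whole coset of the annihilator. By [annP] this
    coset is swept out by adding a common covector to both slots, which is the free xi. *)
Definition form_splitting (p : M) (v : 'cV[R]_n) : set 'cV[R]_((n + n) + (n + n)) :=
  [set e | exists xi, e = pair_part (col_mx v xi) (col_mx v (xi - F p *m v))].

Lemma opp_prod_pairing (z : prod_manifold M M) (X0 X1 Y0 Y1 xi0 xi1 eta0 eta1 : 'cV[R]_n) :
  pairing EE z (col_mx (col_mx X0 X1) (col_mx xi0 xi1))
    (col_mx (col_mx Y0 Y1) (col_mx eta0 eta1)) =
  - (dot xi0 Y0 + dot eta0 X0) + (dot xi1 Y1 + dot eta1 X1).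
Proof.
rewrite -!pair_part_col /= !fst_pair_part !snd_pair_part !std_pairingE.
by rewrite /cpair !(col_mxKu, col_mxKd).
Qed.

(** Conormal covectors of the diagonal are the (- z, z). The opposite pairing on the first factor
    changes the sign of the first slot, so the elements of E dual to them have equal covectors z. *)
Lemma annP p a : ann EE diag p a <->
  exists z, a = pair_part (col_mx 0 z) (col_mx 0 z).
Proof.
split=> [[zeta z0 H]|[z ->]]; last first.
  exists (col_mx (- z) z) => [v|e].
    by rewrite diag_tangent_map mulmxA tr_col_mx mul_row_col !mulmx1 linearN /= addNr mul0mx.
  rewrite -(vsubmxK e) -(vsubmxK (usubmx e)) -(vsubmxK (dsubmx e)).
  rewrite pair_part_col opp_prod_pairing /= col_mxKu !dot0r !addr0.
  by rewrite tr_col_mx mul_row_col mxE -/(dot _ _) -/(dot z _) dotNl.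
move: H; rewrite -(vsubmxK a) -(vsubmxK (usubmx a)) -(vsubmxK (dsubmx a)).
set X0 := usubmx (usubmx a); set X1 := dsubmx (usubmx a).
set x0 := usubmx (dsubmx a); set x1 := dsubmx (dsubmx a) => H.
have {}H Y0 Y1 b0 b1 : - (dot x0 Y0 + dot b0 X0) + (dot x1 Y1 + dot b1 X1) =
    dot (usubmx zeta) Y0 + dot (dsubmx zeta) Y1.
  rewrite -(opp_prod_pairing (diag p)) H /= col_mxKu -{1}[zeta]vsubmxK.
  by rewrite tr_col_mx mul_row_col mxE.
(* [H] holds for arbitrary test vectors and covectors; keeping one of the four at a time determines
   one component of a. *)
have X00 : X0 = 0.
  apply: dot_inj => b; apply: oppr_inj.
  by have := H 0 0 b 0; rewrite !(dot0r, dot0l, add0r, addr0, oppr0).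
have X10 : X1 = 0.
  apply: dot_inj => b.
  by have := H 0 0 0 b; rewrite !(dot0r, dot0l, add0r, addr0, oppr0).
have e0 : - x0 = usubmx zeta.
  apply: dot_inj => y; rewrite [LHS]dotC [RHS]dotC dotNl.
  by have := H y 0 0 0; rewrite !(dot0r, dot0l, add0r, addr0, oppr0).
have e1 : x1 = dsubmx zeta.
  apply: dot_inj => y; rewrite [LHS]dotC [RHS]dotC.
  by have := H 0 y 0 0; rewrite !(dot0r, dot0l, add0r, addr0, oppr0).
have e2 : usubmx zeta + dsubmx zeta = 0.
  apply: dot_inj => y; rewrite dot0r dotC.
  have := z0 y; rewrite diag_tangent_map -{1}[zeta]vsubmxK mulmxA tr_col_mx.
  rewrite mul_row_col !mulmx1 -linearD /= => /(congr1 (fun A : 'M_1 => A 0 0)).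
  by rewrite [RHS]mxE.
exists x1; rewrite pair_part_col X00 X10; congr (col_mx _ (col_mx _ _)).
by apply/eqP; rewrite -subr_eq0 -opprB oppr_eq0 -[x1 - x0]addrC e0 e1 e2.
Qed.

Lemma ann_coset_graph p v xi :
  ann_coset EE diag p (pair_part (col_mx v xi) (col_mx v (xi - F p *m v))) =
  form_splitting p v.
Proof.
apply/seteqP; split=> [_ [_ /annP[z ->] <-]|_ [eta ->]].
  exists (xi + z); rewrite !pair_part_col !add_col_mx !addr0.
  by rewrite addrAC.
exists (pair_part (col_mx 0 (eta - xi)) (col_mx 0 (eta - xi))).
  by apply/annP; exists (eta - xi).
rewrite !pair_part_col !add_col_mx !addr0 addrC subrK.
by congr (col_mx _ (col_mx _ _)); rewrite addrC addrA subrK.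
Qed.

Lemma form_splitting_lift p : ct_lift EE diag form_splitting p = form_graph F p.
Proof.
apply/seteqP; split=> [e [_ [v ev]]|e [X [xi ->]]].
  have : form_splitting p v e.
    rewrite -ev; exists 0; last by rewrite addr0.
    by apply/annP; exists 0; rewrite pair_part_col !col_mx0.
  by move=> [xi ->]; exists v, xi.
split; last by exists X; exact: ann_coset_graph.
by exists X; rewrite diag_tangent_map delta_colM /= pair_part_col col_mxKu.
Qed.

End Trivialization.
End Diagonal.

(** * The Courant trivialization given by a closed 2-form *)

Section Trivialization.
Context {R : realType} {n : nat} {M : manifold R n}.
Implicit Types (p q : M).

Local Notation phi p := (chart_fun (chart_at p)).
Local Notation phiV p := (chart_inv (chart_at p)).
Local Notation dom p := (chart_dom (chart_at p)).
Local Notation diag := (diagonal_map (M := M)).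
Local Notation EE := (opp_prod_courant M M).

Variable F : M -> 'M[R]_n.
Hypothesis hF : closed_2form F.

Let FT p : (F p)^T = - F p.
Proof. exact: cf_skew hF p. Qed.

Let Fskew p (x y : 'cV[R]_n) : dot (F p *m x) y = - dot (F p *m y) x.
Proof. by rewrite -[F p in LHS]trmxK dot_trmxl FT mulNmx dotNr dotC. Qed.

Lemma form_splitting_smooth (W : set M) (X : M -> 'cV[R]_n) : open W ->
  smooth_field (@vec_act R n) W X ->
  exists2 e, smooth_along diag W e & forall p, W p -> form_splitting F p (X p) (e p).
Proof.
move=> oW sX.
exists (fun p => pair_part (col_mx (X p) 0) (col_mx (X p) (0 - F p *m X p)));
  last by move=> p _; exists 0.
move=> p; have oD := @open_chart_image _ _ M W p oW.
apply: (@smooth_on_subset _ _ _ _ (phi p @` (W `&` dom p))).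
  by move=> _ [q [Wdq _] <-]; exists q.
have sF : smooth_on (phi p @` (W `&` dom p)) (local_rep (@form_act R n) F p).
  by apply: smooth_on_subset (cf_smooth hF p) => _ [q [_ dq] <-]; exists q.
have sN := smooth_on_lin (@oppmx_linear R n 1) oD (smooth_on_mulmx oD sF (sX p)).
have s0 := @smooth_on_cst R 'cV[R]_n 'cV[R]_n (phi p @` (W `&` dom p)) 0.
apply: smooth_on_ext (smooth_on_col_mx_pair oD
  (smooth_on_col_mx_pair oD (sX p) (sX p)) (smooth_on_col_mx_pair oD s0 sN)) => //.
move=> x /chart_imageP[_ px _].
have uT := transition_unit px.
cbv beta zeta; rewrite (diag_transition px) cou_act_pair_part // !cou_act_col.
rewrite pair_part_col.
by rewrite mulmx0 sub0r mulmxN /local_rep form_vec_act.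
Qed.

Section Involutive.
Variables (W : set (prod_manifold M M)) (oW : open W) (p : M) (Wp : W (diag p)).
Let x0 := phi p p.
Let Fl := local_rep (@form_act R n) F p.
Let dF := partial (@form_act R n) F p.

Let dFl : differentiable Fl x0.
Proof. exact: smooth_field_differentiable Logic.I (cf_smooth hF). Qed.

Lemma near_diag : \forall x \near x0,
  [/\ W (diag (phiV p x)), dom p (phiV p x) & phi p (phiV p x) = x].
Proof.
have oV : open (diag @^-1` W).
  by apply: open_comp oW => q _; have [c _] := @diag_smooth_map _ _ M; exact: c.
by apply: filterS (near_chart oV Wp) => x /chart_imageP.
Qed.

(** Transition matrices of the product are block diagonal, and the linear map [flip] commutes with
    their action; so it commutes with taking components in the chart and with differentiating
    them. *)
Lemma partial_flip (e : prod_manifold M M -> 'cV[R]_((n + n) + (n + n))) j :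
  smooth_field (@cou_act R (n + n)) W e ->
  partial (@cou_act R (n + n)) (fun z => flip (e z)) (diag p) j =
  flip (partial (@cou_act R (n + n)) e (diag p) j).
Proof.
move=> se; rewrite /partial.
rewrite (@near_eq_derive _ _ _ _
  (fun x => flip (local_rep (@cou_act R (n + n)) e (diag p) x))).
  rewrite (derive_lin (@flip_linear R n n)) //.
  exact: smooth_field_differentiable Wp se.
apply: filterS (near_chart_at (dom_chart_at (diag p))) => x [[d1 d2] _].
rewrite /local_rep; set q := chart_inv _ _ in d1 d2 *.
have u1 := transition_unit d1; have u2 := transition_unit d2.
by rewrite prod_transition // cou_act_flip.
Qed.

Section GraphSection.
Variable e : prod_manifold M M -> 'cV[R]_((n + n) + (n + n)).
Hypothesis se : smooth_field (@cou_act R (n + n)) W e.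
Hypothesis ge : forall q, W (diag q) -> form_graph F q (e (diag q)).

(** The chart representative restricted to the diagonal, the only place where e is known to lie in
    the graph. Differentiating E sees exactly the directions (u, u). *)
Let E x := local_rep (@cou_act R (n + n)) e (diag p) (col_mx x x).
Let X x := usubmx (usubmx (E x)).
Let xi x := usubmx (dsubmx (E x)).

Let E_graph x : W (diag (phiV p x)) -> dom p (phiV p x) ->
  E x = col_mx (col_mx (X x) (X x)) (col_mx (xi x) (xi x - Fl x *m X x)).
Proof.
move=> Wx px; rewrite /X /xi.
have -> : E x = cou_act (transition (diag p) (diag (phiV p x))) (e (diag (phiV p x))).
  by rewrite /E /local_rep /= col_mxKu col_mxKd.
have uT := transition_unit px.
have [Y [eta ->]] := ge Wx.
rewrite diag_transition // cou_act_pair_part // !cou_act_col pair_part_col.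
rewrite !(col_mxKu, col_mxKd) mulmxBr -(form_vec_act uT).
by [].
Qed.

Let diag_linear : linear (fun x : 'cV[R]_n => col_mx x x).
Proof. by move=> a u v; rewrite scale_col_mx add_col_mx. Qed.

Let dE0 : differentiable (local_rep (@cou_act R (n + n)) e (diag p)) (col_mx x0 x0).
Proof. exact: smooth_field_differentiable Wp se. Qed.

Let dE : differentiable E x0.
Proof.
apply: (differentiable_comp (f := fun x => col_mx x x)) => //.
exact: (differentiable_lin (f := id) diag_linear).
Qed.

Let derive_E u :
  'D_u E x0 = 'D_(col_mx u u) (local_rep (@cou_act R (n + n)) e (diag p)) (col_mx x0 x0).
Proof. exact: derive_diag dE0. Qed.

Let dX : differentiable X x0.
Proof.
apply: (differentiable_lin (@usubmx_linear R n n)).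
exact: (differentiable_lin (@usubmx_linear R (n + n) (n + n)) dE).
Qed.

Let dxi : differentiable xi x0.
Proof.
apply: (differentiable_lin (@usubmx_linear R n n)).
exact: (differentiable_lin (@dsubmx_linear R (n + n) (n + n)) dE).
Qed.

(** Supplies the value and the [graph_derivative] condition required by [graph_bracket]; the Leibniz
    rule for F X produces the term with [dF]. *)
Lemma graph_section_at : exists x xi' : 'cV[R]_n,
  e (diag p) = col_mx (col_mx x x) (col_mx xi' (xi' - F p *m x)) /\
  forall u, exists x' xi'' : 'cV[R]_n,
    jac_mx (partial (@cou_act R (n + n)) (fun z => flip (e z)) (diag p)) *m col_mx u u
    = col_mx (col_mx x' x')
        (col_mx (- xi'') (xi'' - (along dF u *m x + F p *m x'))) .
Proof.
exists (X x0), (xi x0).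
have E0 : E x0 = e (diag p) by rewrite -[LHS]/(local_rep _ e _ _) local_rep_at cou_act1.
have F0 : Fl x0 = F p by rewrite /Fl local_rep_at form_act1.
have [Wx px _] := nbhs_singleton near_diag.
split; first by rewrite -E0 E_graph // F0.
move=> u; exists ('D_u X x0), ('D_u xi x0).
have -> : jac_mx (partial (@cou_act R (n + n)) (fun z => flip (e z)) (diag p))
    *m col_mx u u = flip ('D_u E x0).
  rewrite jac_mxM derive_E -(along_partial _ dE0) -(along_linear _ _ (@flip_linear R n n)).
  by apply: eq_along => j; exact: partial_flip.
have dFX : differentiable (fun x => Fl x *m X x) x0 by exact: differentiable_mulmx.
have dNFX : differentiable (fun x => - (Fl x *m X x)) x0.
  exact: (differentiable_lin (@oppmx_linear R n 1)).
have dY : differentiable (fun x => xi x - Fl x *m X x) x0 by exact: differentiableD dxi dNFX.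
have dXX := differentiable_col_mx dX dX; have dxY := differentiable_col_mx dxi dY.
rewrite (@near_eq_derive _ _ _ _ (fun x => col_mx (col_mx (X x) (X x))
   (col_mx (xi x) (xi x - Fl x *m X x)))); last first.
  by apply: filterS near_diag => x [Wx' px' _]; exact: E_graph.
rewrite (derive_col_mx u dXX dxY) (derive_col_mx u dX dX) (derive_col_mx u dxi dY).
rewrite (derive_addf u dxi dNFX) (derive_lin (@oppmx_linear R n 1) u dFX).
rewrite (derive_mulmx u dFl dX) F0 -(along_partial u dFl).
by rewrite flip_col.
Qed.

End GraphSection.
Let closedF (x y w : 'cV[R]_n) :
  dot w (along dF x *m y) - dot w (along dF y *m x) + dot y (along dF w *m x) = 0.
Proof.
(* Contracting with the identity matrix puts dF = 0 into the form of [schouten_vectors], which then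
   evaluates it on arbitrary vectors. *)
have H a b c : \sum_l ((1%:M : 'M[R]_n) l a * dF l b c + (1%:M : 'M[R]_n) l b * dF l c a
    + (1%:M : 'M[R]_n) l c * dF l a b) = 0.
  rewrite -[RHS](cf_closed hF p a b c) !big_split /=.
  have pick k (f : 'I_n -> R) : \sum_l (1%:M : 'M[R]_n) l k * f l = f k.
    rewrite (bigD1 k) //= big1 ?addr0 => [|l /negbTE lk]; rewrite mxE ?eqxx ?mul1r //.
    by rewrite lk mul0r.
  by rewrite !pick.
have := schouten_vectors H w x y; rewrite !mul1mx => H'.
have dFT v : (along dF v)^T = - along dF v.
  rewrite along_tr -along_opp; apply: eq_along => j.
  rewrite -[LHS]opprK; congr (- _); apply/esym.
  apply: (partial_lin (@opp_trmx_linear R n) openT) (cf_smooth hF) => // q T _ _.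
  by rewrite /form_act !trmx_mul trmxK FT mulNmx mulmxN opprK mulmxA.
have skew a b v : dot a (along dF v *m b) = - dot b (along dF v *m a).
  by rewrite -dot_trmxl dFT mulNmx dotNl dotC.
by rewrite -[RHS]H' (skew x w y) addrAC.
Qed.

Lemma form_graph_bracket (e e' : prod_manifold M M -> 'cV[R]_((n + n) + (n + n))) :
  smooth_field (@cou_act R (n + n)) W e -> smooth_field (@cou_act R (n + n)) W e' ->
  (forall q, W (diag q) -> form_graph F q (e (diag q))) ->
  (forall q, W (diag q) -> form_graph F q (e' (diag q))) ->
  form_graph F p (bracket EE e e' (diag p)).
Proof.
move=> se se' ge ge'.
have [x [xi [ep De]]] := graph_section_at se ge.
have [y [eta [e'p De']]] := graph_section_at se' ge'.
have FTp := FT p.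
have [z [c B]] := graph_bracket FTp closedF xi eta De De'.
(* [graph_bracket] describes the bracket before the outer [flip], which reverses the first covector
   c. *)
exists z, (- c); rewrite pair_part_col.
have -> : bracket EE e e' (diag p) = flip (bracket_formula (flip (e (diag p)))
    (flip (e' (diag p)))
    (jac_mx (partial (@cou_act R (n + n)) (fun w => flip (e w)) (diag p)))
    (jac_mx (partial (@cou_act R (n + n)) (fun w => flip (e' w)) (diag p)))) by [].
by rewrite ep e'p !flip_col B flip_col addrC.
Qed.

End Involutive.

Lemma form_splitting_trivialization :
  courant_trivialization EE diag (form_splitting F).
Proof.
split.
- move=> p v; exists (pair_part (col_mx v 0) (col_mx v (0 - F p *m v))).
    by rewrite diag_tangent_map delta_colM /= pair_part_col col_mxKu.
  by rewrite ann_coset_graph.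
- move=> p a v w _ _ [xi ->] [eta ->]; exists (a *: xi + eta).
  rewrite !pair_part_col !scale_col_mx !add_col_mx; congr (col_mx _ (col_mx _ _)).
  by rewrite mulmxDr -scalemxAr scalerBr opprD addrACA.
- exact: form_splitting_smooth.
- move=> p v w _ _ [xi ->] [eta ->].
  rewrite !pair_part_col opp_prod_pairing !dotDl !dotNl (Fskew p w v).
  by ring.
- move=> W e e' oW se se' ge ge' p Wp.
  have lift q (f : 'cV[R]_((n + n) + (n + n))) :
      ct_lift EE diag (form_splitting F) q f -> form_graph F q f.
    by rewrite form_splitting_lift.
  rewrite form_splitting_lift; apply: (form_graph_bracket oW Wp se se').
    by move=> q Wq; exact: lift (ge q Wq).
  by move=> q Wq; exact: lift (ge' q Wq).
Qed.

End Trivialization.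

(** * Invariance of the graph *)

Section Invariance.
Context {R : realType} {n : nat} {M : manifold R n}.
Variables (Ii Ij Q F : M -> 'M[R]_n) (p : M).
Hypotheses (QT : (Q p)^T = - Q p) (FT : (F p)^T = - F p).
Hypotheses (IF : Ij p - Ii p = Q p *m F p)
  (FI : F p *m Ij p + (Ii p)^T *m F p = 0).

Let J := opp_prod_end (poisson_gc Ii Q) (poisson_gc Ij Q) (diagonal_map p).

Let IjT : (Ij p)^T = (Ii p)^T + F p *m Q p.
Proof.
rewrite -[Ij p](subrK (Ii p)) IF linearD /= trmx_mul QT FT mulmxN mulNmx opprK.
by rewrite addrC.
Qed.

Let IjTF : (Ij p)^T *m F p = - (F p *m Ii p).
Proof.
have := congr1 trmx FI.
rewrite linearD /= !trmx_mul trmxK FT trmx0 mulmxN mulNmx.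
by move=> /eqP; rewrite -opprD oppr_eq0 addr_eq0 => /eqP.
Qed.

Lemma gc_form_graph e : form_graph F p e -> form_graph F p (J e).
Proof.
move=> [X [xi ->]]; rewrite /J /opp_prod_end fst_pair_part snd_pair_part.
(* The witnesses are the components of J_i (X + xi), forced by the first factor. The second factor
   then has to produce the same vector and the covector shifted by F. *)
exists (Ii p *m X + Q p *m xi), (- ((Ii p)^T *m xi)); congr pair_part.
  by rewrite [LHS]gc_blockM !(col_mxKu, col_mxKd).
rewrite [LHS]gc_blockM !(col_mxKu, col_mxKd); congr col_mx.
  by rewrite -[Ij p](subrK (Ii p)) IF mulmxBr mulmxDl !mulmxA addrC addrA subrK addrC.
rewrite mulmxBr mulmxA IjTF IjT mulmxDl mulmxDr !mulmxA mulNmx opprK !opprD.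
by rewrite -addrA [- _ - _]addrC.
Qed.

(** Since the inverse of J is - J and the graph is stable under sign, the inclusion of
    [gc_form_graph] is already an equality. *)
Lemma gc_form_graph_image : 
  (forall e, J (J e) = - e) -> J @` form_graph F p = form_graph F p.
Proof.
move=> JJ; apply/seteqP; split=> [_ [e ge <-]|e ge]; first exact: gc_form_graph.
have gN f : form_graph F p f -> form_graph F p (- f).
  move=> [X [xi ->]]; exists (- X), (- xi).
  by rewrite !pair_part_col !opp_col_mx mulmxN opprB opprK addrC.
by exists (J (- e)); [exact/gc_form_graph/gN|rewrite JJ opprK].
Qed.

End Invariance.

Lemma opp_prod_end_sqr (R : realType) m n (M : manifold R m) (N : manifold R n)
    (J0 : M -> 'M[R]_(m + m)) (J1 : N -> 'M[R]_(n + n)) (z : prod_manifold M N) e :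
  (forall p, J0 p *m J0 p = - 1%:M) -> (forall p, J1 p *m J1 p = - 1%:M) ->
  opp_prod_end J0 J1 z (opp_prod_end J0 J1 z e) = - e.
Proof.
move=> h0 h1; rewrite /opp_prod_end fst_pair_part snd_pair_part !mulmxA h0 h1.
rewrite !mulNmx !mul1mx -[in RHS](pair_partK e).
rewrite -[fst_part e]vsubmxK -[snd_part e]vsubmxK.
by rewrite !opp_col_mx !pair_part_col !(col_mxKu, col_mxKd).
Qed.

Theorem proposition7 (R : realType) (n : nat) (M : manifold R n)
    (Ii Ij : M -> 'M[R]_n) (sigmai sigmaj : M -> 'M[R[i]]_n)
    (Q F : M -> 'M[R]_n)
    (hi : holomorphic_poisson Ii sigmai)
    (hj : holomorphic_poisson Ij sigmaj)
    (hQi : forall p : M, ImM (sigmai p) = Q p)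
    (hQj : forall p : M, ImM (sigmaj p) = Q p)
    (hF : closed_2form F)
    (hIF : forall p : M, Ij p - Ii p = Q p *m F p)
    (hFI : forall p : M, F p *m Ij p + (Ii p)^T *m F p = 0) :
  exists s : M -> 'cV[R]_n -> set 'cV[R]_((n + n) + (n + n)),
    [/\ courant_trivialization (opp_prod_courant M M) (diagonal_map (M := M)) s,
        forall p : M,
          ct_lift (opp_prod_courant M M) (diagonal_map (M := M)) s p
          = form_graph F p,
        gc_submanifold (opp_prod_courant M M) (diagonal_map (M := M))
          (opp_prod_end (poisson_gc Ii Q) (poisson_gc Ij Q)) s
      & gc_isomorphism (poisson_gc Ii Q) (poisson_gc Ij Q) (fun p : M => p) s].
Proof.
have gi : generalized_complex (poisson_gc Ii Q).
  rewrite (_ : Q = fun p => ImM (sigmai p)); last exact/funext.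
  exact: poisson_generalized_complex hi.
have gj : generalized_complex (poisson_gc Ij Q).
  rewrite (_ : Q = fun p => ImM (sigmaj p)); last exact/funext.
  exact: poisson_generalized_complex hj.
have sub : gc_submanifold (opp_prod_courant M M) (diagonal_map (M := M))
    (opp_prod_end (poisson_gc Ii Q) (poisson_gc Ij Q)) (form_splitting F).
  split; [exact: diag_embedding|exact: form_splitting_trivialization|move=> p].
  rewrite form_splitting_lift; apply: gc_form_graph_image => //.
  - by rewrite -hQi; exact: hp_im_skew hi p.
  - exact: cf_skew hF p.
  - by move=> e; apply: opp_prod_end_sqr; [exact: gc_sqr gi|exact: gc_sqr gj].
exists (form_splitting F); split=> //.
- exact: form_splitting_trivialization.
- exact: form_splitting_lift.
(* The graph map of the identity unfolds to [diagonal_map], so the submanifold statement over the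
   diagonal serves unchanged. *)
- by split=> //; exact: id_diffeomorphism.
Qed.
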